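(* Let $c\ge 1$, and let $G=\langle A\mid R\rangle_{\mathcal N_c}=\langle a_1,\dots,a_n\mid r_1,\dots,r_m\rangle_{\mathcal N_c}$ be a finitely generated nilpotent group given by a finite full rank presentation in the variety $\mathcal N_c$. Then there exists a subset $A_0\subseteq A$ with $|A_0|=n-m$ (with $A_0=\emptyset$ if $m\ge n$) such that the following holds: 1. If $m\ge n$, then $G$ is finite. 2. If $m=n-1$, then $\langle A_0\rangle$ is infinite cyclic and has finite index in $G$. 3. If $m\le n-2$, then $\langle A_0\rangle$ is a free $c$-step nilpotent subgroup of rank $n-m$ which has finite index in $G$. Furthermore, (when $m<n$) $A_0$ can be chosen to be any subset $\{a_{i_1},\dots,a_{i_{n-m}}\}$ of $A$ such that the rank of the matrix $M(A,R)$ coincides with the rank of the matrix obtained from $M(A,R)$ by removing its $i_1,\dots,i_{n-m}$-th columns.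
   Context: $A=\{a_1,\dots,a_n\}$ is a finite alphabet with $n$ letters and $R=\{r_1,\dots,r_m\}$ is a finite set of words in $A^{\pm1}$. $\mathcal N_c$ is the variety of all nilpotent groups of class at most $c$. The free group in $\mathcal N_c$ with basis $A$ is $N_c(A)=F(A)/\gamma_{c+1}(F(A))$, where $F(A)$ is the free group on $A$ and $\gamma_1(H)=H$, $\gamma_{k+1}(H)=[\gamma_k(H),H]$. $\langle A\mid R\rangle_{\mathcal N_c}$ denotes the group $N_c(A)/\langle\langle R\rangle\rangle$, where $\langle\langle R\rangle\rangle$ is the normal closure of $R$. $\langle A_0\rangle$ denotes the subgroup of $G$ generated by the images of the elements of $A_0$. A free $c$-step nilpotent group of rank $k$ is a group isomorphic to $F/\gamma_{c+1}(F)$ with $F$ free of rank $k$. The relation matrix $M(A,R)$ is the $m\times n$ integer matrix whose $(i,j)$ entry is the sum of the exponents of all occurrences of $a_j$ in $r_i$. The presentation has full rank if $\operatorname{rank} M(A,R)=\min\{m,n\}$. *)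

(* Defs.v *)
From HB Require Import structures.
From mathcomp Require Import all_boot all_order all_algebra.
From mathcomp Require Import boolp classical_sets functions cardinality.

Set Implicit Arguments.
Unset Strict Implicit.
Unset Printing Implicit Defensive.

Local Open Scope classical_set_scope.
Local Open Scope group_scope.
Local Open Scope quotient_scope.

(* [{group gT}] requires a finite [gT]; subgroups of an arbitrary [groupType]
   are classical sets here. *)

Definition is_subgroup (G : groupType) (H : set G) : Prop :=
  [/\ H 1, forall x y, H x -> H y -> H (x * y) & forall x, H x -> H x^-1].

Definition is_normal (G : groupType) (H : set G) : Prop :=
  is_subgroup H /\ forall x y, H x -> H (x ^ y).

Definition generated (G : groupType) (S : set G) : set G :=
  smallest (@is_subgroup G) S.

Definition normal_closure (G : groupType) (S : set G) : set G :=
  smallest (@is_normal G) S.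

Definition commutator_subgroup (G : groupType) (H K : set G) : set G :=
  generated [set [~ p.1, p.2] | p in H `*` K].

(* Indexed from 1, as in the literature; the value at 0 is junk. *)
Fixpoint lower_central (G : groupType) (k : nat) : set G :=
  match k with
  | k'.+1 =>
    if k' is 0 then [set: G]
    else commutator_subgroup (@lower_central G k') [set: G]
  | 0 => [set: G]
  end.
Arguments lower_central : clear implicits.

Definition finite_index (G : groupType) (H : set G) : Prop :=
  finite_set (range (fun x : G => [set x * h | h in H])).

Definition infinite_cyclic (G : groupType) (H : set G) : Prop :=
  (exists x, H = generated [set x]) /\ infinite_set H.

Lemma generated_subgroup (G : groupType) (S : set G) :
  is_subgroup (generated S).
Proof.
split=> [H [[H1 _ _] _] //|x y Sx Sy H HS|x Sx H HS].
- by case: (HS) => -[_ HM _] _; apply: HM; [exact: Sx|exact: Sy].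
- by case: (HS) => -[_ _ HV] _; apply: HV; exact: Sx.
Qed.

Lemma normal_closure_normal (G : groupType) (S : set G) :
  is_normal (normal_closure S).
Proof.
split; first split=> [H [[[H1 _ _] _] _] //|x y Sx Sy H HS|x Sx H HS].
- by case: (HS) => -[[_ HM _] _] _; apply: HM; [exact: Sx|exact: Sy].
- by case: (HS) => -[[_ _ HV] _] _; apply: HV; exact: Sx.
- by move=> x y Sx H HS; case: (HS) => -[_ HJ] _; apply: HJ; exact: Sx.
Qed.

Lemma commutator_subgroup_normal (G : groupType) (H K : set G) :
  is_normal H -> is_normal K -> is_normal (commutator_subgroup H K).
Proof.
move=> [_ HJ] [_ KJ]; split; first exact: generated_subgroup.
move=> x y Sx.
have [g1 gM gV] :=
  generated_subgroup [set [~ p.1, p.2] | p in H `*` K].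
apply: (Sx [set z | commutator_subgroup H K (z ^ y)]); split.
  split=> [|u v /= Hu Hv|u /= Hu]; first by rewrite /= conj1g; exact: g1.
  - by rewrite conjMg; exact: gM.
  - by rewrite conjVg; exact: gV.
move=> _ [[u v] [/= Hu Kv] <-] /=; rewrite conjRg.
apply: sub_gen_smallest; exists (u ^ y, v ^ y) => //=.
by split; [exact: HJ|exact: KJ].
Qed.

Lemma lower_central_normal (G : groupType) (k : nat) :
  is_normal (lower_central G k).
Proof.
have T : is_normal [set: G] by [].
by elim: k => [//|[//|k] IHk]; exact: commutator_subgroup_normal.
Qed.

Record normal_subgroup (G : groupType) := NormalSubgroup {
  normal_carrier : set G;
  normal_carrierP : is_normal normal_carrier }.

Section QuotientGroup.
Variables (G : groupType) (N : normal_subgroup G).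

Definition coset_rel : rel G := fun x y => `[< normal_carrier N (x^-1 * y) >].

Lemma coset_rel_refl : reflexive coset_rel.
Proof.
move=> x; apply/asboolP; rewrite mulVg.
by have [[]] := normal_carrierP N.
Qed.

Lemma coset_rel_sym : symmetric coset_rel.
Proof.
suff S x y : coset_rel x y -> coset_rel y x by move=> x y; apply/idP/idP => /S.
move/asboolP => Nxy; apply/asboolP.
have [[_ _ NV] _] := normal_carrierP N.
by move: (NV _ Nxy); rewrite invgM invgK.
Qed.

Lemma coset_rel_trans : transitive coset_rel.
Proof.
move=> y x z /asboolP Nxy /asboolP Nyz; apply/asboolP.
have [[_ NM _] _] := normal_carrierP N.
by move: (NM _ _ Nxy Nyz); rewrite -mulgA mulVKg.
Qed.

Canonical coset_equiv :=
  EquivRel coset_rel coset_rel_refl coset_rel_sym coset_rel_trans.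

Definition quotient_group : Type := {eq_quot coset_equiv}.
HB.instance Definition _ := Choice.on quotient_group.
HB.instance Definition _ := EqQuotient.on quotient_group.

Definition to_quotient (x : G) : quotient_group := \pi_quotient_group x.

Let q_mul (a b : quotient_group) : quotient_group :=
  to_quotient (repr a * repr b).
Let q_inv (a : quotient_group) : quotient_group := to_quotient (repr a)^-1.
Let q_one : quotient_group := to_quotient 1.

Lemma to_quotientP (x y : G) :
  to_quotient x = to_quotient y <-> normal_carrier N (x^-1 * y).
Proof.
split=> [/eqP|H]; first by rewrite eqmodE => /asboolP.
by apply/eqP; rewrite eqmodE; apply/asboolP.
Qed.

Let repr_quotient (x : G) :
  normal_carrier N ((repr (to_quotient x))^-1 * x).
Proof. by apply/to_quotientP; rewrite /to_quotient reprK. Qed.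

Let q_mulE x y : q_mul (to_quotient x) (to_quotient y) = to_quotient (x * y).
Proof.
apply/to_quotientP.
have [[_ NM _] NJ] := normal_carrierP N.
have := NM _ _ (NJ _ (repr (to_quotient y)) (repr_quotient x))
               (repr_quotient y).
by rewrite conjgE invgM !mulgA mulgK.
Qed.

Let q_invE x : q_inv (to_quotient x) = to_quotient x^-1.
Proof.
apply/to_quotientP.
have [[_ _ NV] NJ] := normal_carrierP N.
have := NJ _ (repr (to_quotient x))^-1 (NV _ (repr_quotient x)).
by rewrite conjgE invgM !invgK !mulgA mulgK.
Qed.

Let quotientW (P : quotient_group -> Prop) :
  (forall x, P (to_quotient x)) -> forall a, P a.
Proof. by move=> Px a; rewrite -[a]reprK; exact: Px. Qed.

Let q_mulA : associative q_mul.
Proof.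
by elim/quotientW=> x; elim/quotientW=> y; elim/quotientW=> z;
  rewrite !q_mulE mulgA.
Qed.
Let q_mul1 : left_id q_one q_mul.
Proof. by elim/quotientW=> x; rewrite q_mulE mul1g. Qed.
Let q_mulr1 : right_id q_one q_mul.
Proof. by elim/quotientW=> x; rewrite q_mulE mulg1. Qed.
Let q_mulV : left_inverse q_one q_inv q_mul.
Proof. by elim/quotientW=> x; rewrite q_invE q_mulE mulVg. Qed.
Let q_mulrV : right_inverse q_one q_inv q_mul.
Proof. by elim/quotientW=> x; rewrite q_invE q_mulE mulgV. Qed.

HB.instance Definition _ :=
  isGroup.Build quotient_group q_mulA q_mul1 q_mulr1 q_mulV q_mulrV.

Lemma to_quotientM x y : to_quotient (x * y) = to_quotient x * to_quotient y.
Proof. by rewrite -q_mulE. Qed.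

End QuotientGroup.

(* The letter [(i, false)] is the i-th generator, [(i, true)] its inverse. *)
Definition word (n : nat) := seq ('I_n * bool).

Definition letter_inv (n : nat) (l : 'I_n * bool) := (l.1, ~~ l.2).

Definition word_inv (n : nat) (w : word n) : word n :=
  rev (map (@letter_inv n) w).

Inductive free_equiv (n : nat) : word n -> word n -> Prop :=
| FreeRefl w : free_equiv w w
| FreeSym w1 w2 : free_equiv w1 w2 -> free_equiv w2 w1
| FreeTrans w1 w2 w3 :
    free_equiv w1 w2 -> free_equiv w2 w3 -> free_equiv w1 w3
| FreeCancel (u v : word n) l :
    free_equiv (u ++ l :: letter_inv l :: v) (u ++ v).

Section FreeGroup.
Variable n : nat.
Implicit Types u v w : word n.

Definition free_rel : rel (word n) := fun u v => `[< free_equiv u v >].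

Lemma free_rel_refl : reflexive free_rel.
Proof. by move=> w; apply/asboolP; exact: FreeRefl. Qed.

Lemma free_rel_sym : symmetric free_rel.
Proof.
by move=> u v; apply/idP/idP => /asboolP H; apply/asboolP; exact: FreeSym.
Qed.

Lemma free_rel_trans : transitive free_rel.
Proof.
by move=> v u w /asboolP H /asboolP K; apply/asboolP; exact: FreeTrans H K.
Qed.

Canonical free_rel_equiv :=
  EquivRel free_rel free_rel_refl free_rel_sym free_rel_trans.

Definition free_group : Type := {eq_quot free_rel_equiv}.
HB.instance Definition _ := Choice.on free_group.
HB.instance Definition _ := EqQuotient.on free_group.

Definition free_of_word (w : word n) : free_group := \pi_free_group w.

Lemma free_of_wordP u v : free_of_word u = free_of_word v <-> free_equiv u v.
Proof.
split=> [/eqP|H]; first by rewrite eqmodE => /asboolP.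
by apply/eqP; rewrite eqmodE; apply/asboolP.
Qed.

Let letter_invK : involutive (@letter_inv n).
Proof. by case=> i b; rewrite /letter_inv /= negbK. Qed.

Let free_equiv_cat u1 u2 v1 v2 :
  free_equiv u1 u2 -> free_equiv v1 v2 -> free_equiv (u1 ++ v1) (u2 ++ v2).
Proof.
move=> Hu Hv; apply: (@FreeTrans _ _ (u2 ++ v1)).
- elim: Hu => [w|? ? _|? ? ? _ H1 _ H2|u v l]; first exact: FreeRefl.
  + exact: FreeSym.
  + exact: FreeTrans H1 H2.
  + by rewrite -!catA; exact: FreeCancel.
- elim: Hv => [w|? ? _|? ? ? _ H1 _ H2|u v l]; first exact: FreeRefl.
  + exact: FreeSym.
  + exact: FreeTrans H1 H2.
  + by rewrite !catA; exact: FreeCancel.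
Qed.

Let free_equiv_inv u v :
  free_equiv u v -> free_equiv (word_inv u) (word_inv v).
Proof.
elim=> [w|? ? _|? ? ? _ H1 _ H2|w1 w2 l]; first exact: FreeRefl.
- exact: FreeSym.
- exact: FreeTrans H1 H2.
rewrite /word_inv !map_cat !rev_cat /= !rev_cons letter_invK -!cats1 -!catA /=.
have := FreeCancel (rev (map (@letter_inv n) w2))
                   (rev (map (@letter_inv n) w1)) l.
by [].
Qed.

Let free_equiv_invr w : free_equiv (w ++ word_inv w) [::].
Proof.
elim: w => [|l w IH] /=; first exact: FreeRefl.
rewrite /word_inv /= rev_cons -cats1 -cat1s catA.
apply: (@FreeTrans _ _ ([:: l] ++ [::] ++ [:: letter_inv l])).
  rewrite -catA; apply: free_equiv_cat; first exact: FreeRefl.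
  rewrite catA; apply: free_equiv_cat; [exact: IH|exact: FreeRefl].
exact: (FreeCancel [::] [::] l).
Qed.

Let word_invK : involutive (@word_inv n).
Proof.
by move=> w; rewrite /word_inv map_rev revK -map_comp map_id_in // => l _;
  exact: letter_invK.
Qed.

Let f_mul (a b : free_group) : free_group := free_of_word (repr a ++ repr b).
Let f_inv (a : free_group) : free_group := free_of_word (word_inv (repr a)).
Let f_one : free_group := free_of_word [::].

Let repr_free w : free_equiv (repr (free_of_word w)) w.
Proof. by apply/free_of_wordP; rewrite /free_of_word reprK. Qed.

Let f_mulE u v : f_mul (free_of_word u) (free_of_word v) = free_of_word (u ++ v).
Proof. by apply/free_of_wordP/free_equiv_cat; exact: repr_free. Qed.

Let f_invE u : f_inv (free_of_word u) = free_of_word (word_inv u).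
Proof. by apply/free_of_wordP/free_equiv_inv; exact: repr_free. Qed.

Let freeW (P : free_group -> Prop) :
  (forall w, P (free_of_word w)) -> forall a, P a.
Proof. by move=> Pw a; rewrite -[a]reprK; exact: Pw. Qed.

Let f_mulA : associative f_mul.
Proof.
by elim/freeW=> x; elim/freeW=> y; elim/freeW=> z; rewrite !f_mulE catA.
Qed.
Let f_mul1 : left_id f_one f_mul.
Proof. by elim/freeW=> x; rewrite f_mulE. Qed.
Let f_mulr1 : right_id f_one f_mul.
Proof. by elim/freeW=> x; rewrite f_mulE cats0. Qed.
Let f_mulrV : right_inverse f_one f_inv f_mul.
Proof. by elim/freeW=> x; rewrite f_invE f_mulE; exact/free_of_wordP. Qed.
Let f_mulV : left_inverse f_one f_inv f_mul.
Proof.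
elim/freeW=> x; rewrite f_invE f_mulE; apply/free_of_wordP.
by rewrite -{2}[x]word_invK.
Qed.

HB.instance Definition _ :=
  isGroup.Build free_group f_mulA f_mul1 f_mulr1 f_mulV f_mulrV.

Lemma free_of_wordM u v :
  free_of_word (u ++ v) = free_of_word u * free_of_word v.
Proof. by rewrite -f_mulE. Qed.

End FreeGroup.

Definition free_nilpotent (c n : nat) : groupType :=
  quotient_group
    (NormalSubgroup (lower_central_normal (free_group n) c.+1)).

Definition nilpotent_of_word (c n : nat) (w : word n) : free_nilpotent c n :=
  to_quotient _ (free_of_word w).

(* The group < a_1, ..., a_n | r_1, ..., r_m > in the variety of nilpotent
   groups of class at most c. *)
Definition presented_group (c m n : nat) (r : 'I_m -> word n) : groupType :=
  quotient_group
    (NormalSubgroup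
       (normal_closure_normal (range (fun i => nilpotent_of_word c (r i))))).

Definition presented_gen (c m n : nat) (r : 'I_m -> word n) (j : 'I_n) :
    presented_group c r :=
  to_quotient _ (nilpotent_of_word c [:: (j, false)]).

Definition letters_subgroup (c m n : nat) (r : 'I_m -> word n)
    (A0 : {set 'I_n}) : set (presented_group c r) :=
  generated [set x | exists2 j, j \in A0 & x = presented_gen c r j].
Arguments letters_subgroup c {m n} r A0 _.

Definition is_free_nilpotent (c k : nat) (G : groupType) (H : set G) : Prop :=
  exists f : {multiplicative free_nilpotent c k -> G},
    injective f /\ range f = H.

Definition relation_matrix (m n : nat) (r : 'I_m -> word n) : 'M[int]_(m, n) :=
  (\matrix_(i, j) \sum_(l <- r i | l.1 == j) (-1) ^+ l.2)%R.

Definition int_rank (m n : nat) (M : 'M[int]_(m, n)) : nat :=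
  \rank (map_mx intr M : 'M[rat]_(m, n)).

Definition full_rank (m n : nat) (r : 'I_m -> word n) : Prop :=
  int_rank (relation_matrix r) = minn m n.

Definition remove_cols (m n : nat) (M : 'M[int]_(m, n)) (J : {set 'I_n}) :
    'M[int]_(m, #|~: J|) :=
  colsub (enum_val (A := mem (~: J))) M.

(* Main.v *)
Require Import Defs.
From HB Require Import structures.
From mathcomp Require Import all_boot all_order all_algebra.
From mathcomp Require Import boolp classical_sets functions cardinality.
From mathcomp Require Import zify.

(** Write [gam k] for the [k]-th term of the lower central series and [H] for the
    subgroup generated by the letters of [A0].

    Finite index. The hypothesis on the columns says that, modulo [A0] and the
    relators, every letter has finite order in the abelianization of the
    presented group. So [H] contains a positive power of each letter modulo
    [gam 2] ([layer_letter_power]). Commutators are bilinear between consecutive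
    layers of the lower central series, so in every layer finitely many
    generators have a power in [H], and descending along the series shows that
    [H] has finitely many cosets ([nilpotent_transversal]). When [A0] is empty
    this says that the group is finite.

    Freeness. An element of the free group on [A0] that dies in the presented
    group has to be shown to lie in [gam c.+1]. By the theorem of Magnus
    ([magnus_kernel]) it is enough that it becomes trivial modulo [z ^ c.+1]
    under every homomorphism to units [1 + t z + ...] of an algebra of power
    series with rational coefficients. Such a homomorphism, given on [A0],
    extends to the whole alphabet so that the relators become trivial modulo
    [z ^ c.+1]: the other letters are corrected degree by degree, and at each
    degree the correction solves a linear system whose matrix is the relation
    matrix without the columns of [A0], invertible over the rationals
    ([solve_relations]). Hence the homomorphism factors through the presented
    group, where the element is trivial ([letters_free]).

    The theorem of Magnus rests on the fact that the graded Lie ring of a free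
    group is a free Lie ring and embeds in the free associative algebra. This is
    proved by Lazard elimination. Removing a letter [a] from a free generating
    family and replacing every other letter [b] by the brackets [b, a, ..., a]
    loses only the multiples of [a] ([lie_elim]), and the new family is again free
    in the sense that its leading terms can be made to act in any prescribed way
    ([lie_free_elim], where the action is coinduced on sequences). Removing the
    letters of least weight one after the other leaves only letters of weight
    larger than [c], and then nothing remains to be proved
    ([lie_magnus_kernel]). *)

Set Implicit Arguments.
Unset Strict Implicit.
Unset Printing Implicit Defensive.

Import GRing.Theory Num.Theory.

(** * Integer matrices of full rank *)

Section Matrices.
Local Open Scope ring_scope.

Lemma clear_denominators (p q : nat) (Q : 'M[rat]_(p, q)) :
  exists (N : nat) (Z : 'M[int]_(p, q)),
    (0 < N)%N /\ map_mx intr Z = N%:R *: Q.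
Proof.
pose d (i : 'I_p * 'I_q) : nat := `|denq (Q i.1 i.2)|%N.
pose N := (\prod_i d i)%N.
have d0 i : (0 < d i)%N by rewrite absz_gt0 denq_eq0.
exists N, (\matrix_(i, j) (numq (Q i j) * (\prod_(k | k != (i, j)) d k)%N%:Z)).
split; first by rewrite prodn_gt0.
apply/matrixP => i j; rewrite !mxE /N.
rewrite [in RHS](bigD1 (i, j)) //= natrM rmorphM /=.
rewrite numqE -pmulrn [RHS]mulrC mulrA; congr (_ * _ * _).
by rewrite /d pmulrn abszE gtr0_norm ?denq_gt0.
Qed.

Local Notation ratmx M := (map_mx intr M : 'M[rat]_(_, _)).

Lemma ratmx_inj m n (A B : 'M[int]_(m, n)) : ratmx A = ratmx B -> A = B.
Proof.
by move=> /matrixP AB; apply/matrixP => i j; move: (AB i j); rewrite !mxE => /intr_inj.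
Qed.

(** Clearing the denominators of a one-sided inverse over the rationals leaves a
    scalar matrix instead of the identity; likewise on the other side below. *)
Lemma int_left_inverse m p (M : 'M[int]_(m, p)) : int_rank M = p ->
  exists (N : nat) (Z : 'M[int]_(p, m)), (0 < N)%N /\ Z *m M = (N%:Z)%:M.
Proof.
move=> rM; have fM : row_full (ratmx M) by rewrite /row_full; apply/eqP.
have [N [Z [N0 ZE]]] := clear_denominators (pinvmx (ratmx M)).
exists N, Z; split=> //; apply: ratmx_inj.
by rewrite map_mxM ZE -scalemxAl mulVpmx // map_scalar_mx scalemx1.
Qed.

Lemma int_right_inverse m p (M : 'M[int]_(m, p)) : int_rank M = m ->
  exists (N : nat) (Z : 'M[int]_(p, m)), (0 < N)%N /\ M *m Z = (N%:Z)%:M.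
Proof.
move=> rM; have fM : row_free (ratmx M) by rewrite /row_free; apply/eqP.
have [N [Z [N0 ZE]]] := clear_denominators (pinvmx (ratmx M)).
exists N, Z; split=> //; apply: ratmx_inj.
by rewrite map_mxM ZE -scalemxAr mulmxVp // map_scalar_mx scalemx1.
Qed.

Lemma rank_colsub_le (F : fieldType) m n p q (A : 'M[F]_(m, n))
    (f : 'I_p -> 'I_n) (g : 'I_q -> 'I_n) (h : 'I_p -> 'I_q) :
  f =1 g \o h -> (\rank (colsub f A) <= \rank (colsub g A))%N.
Proof.
move=> fg; rewrite -mxrank_tr -[leqRHS]mxrank_tr !trmx_mxsub.
exact: mxrankS (submx_rowsub h fg).
Qed.

Lemma remove_cols_rank m n (M : 'M[int]_(m, n)) (J : {set 'I_n}) p (f : 'I_p -> 'I_n) :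
  (forall i, f i \notin J) ->
  (\rank (colsub f (ratmx M)) <= int_rank (remove_cols M J))%N.
Proof.
move=> fJ; rewrite /int_rank /remove_cols map_mxsub.
have fJ' i : f i \in ~: J by rewrite inE.
apply: (@rank_colsub_le _ _ _ _ _ _ _ _
  (fun i => enum_rank_in (fJ' i) (f i))) => i /=.
by rewrite enum_rankK_in.
Qed.

Lemma remove_cols_set0 m n (M : 'M[int]_(m, n)) :
  (int_rank M <= int_rank (remove_cols M finset.set0))%N.
Proof.
have := @remove_cols_rank _ _ M finset.set0 n id (fun i => _).
by rewrite mxsub_id; apply=> i; rewrite inE.
Qed.

(** The columns to be kept form a maximal independent family. *)
Lemma independent_columns m n (M : 'M[int]_(m, n)) : int_rank M = m ->
  exists J : {set 'I_n}, #|J| = (n - m)%N /\ int_rank (remove_cols M J) = m.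
Proof.
move=> rM; pose f := maxrankfun (ratmx M)^T.
have rMT : \rank (ratmx M)^T = m by rewrite mxrank_tr.
pose J := ~: [set f i | i : 'I_(\rank (ratmx M)^T)].
have cJ : #|J| = (n - m)%N.
  rewrite cardsCs finset.setCK card_ord card_imset ?card_ord ?rMT //.
  exact: maxrankfun_inj.
exists J; split=> //; apply/eqP; rewrite eqn_leq rank_leq_row /=.
apply: leq_trans (@remove_cols_rank _ _ M J _ f _); last first.
  by move=> i; rewrite !inE negbK imset_f.
by rewrite -mxrank_tr trmx_mxsub eq_maxrowsub rMT.
Qed.
End Matrices.

Local Open Scope classical_set_scope.
Local Open Scope group_scope.

(** * Commutators modulo the lower central series *)

Lemma generated_ind (G : groupType) (S P : set G) :
  is_subgroup P -> (forall x, S x -> P x) -> forall x, generated S x -> P x.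
Proof. by move=> sP SP x Sx; apply: Sx. Qed.

Lemma generated_mem (G : groupType) (S : set G) x : S x -> generated S x.
Proof. exact: sub_gen_smallest. Qed.

Lemma subgroupX (G : groupType) (H : set G) x k : is_subgroup H -> H x -> H (x ^+ k).
Proof.
case=> H1 HM _ Hx; elim: k => [|k IH]; first by rewrite expg0.
by rewrite expgS; exact: HM.
Qed.

Lemma multiplicative1 (G H : groupType) (f : G -> H) :
  {morph f : x y / x * y} -> f 1 = 1.
Proof. by move=> fM; apply: (@mulgI _ (f 1)); rewrite -fM !mulg1. Qed.

HB.instance Definition _ (G : groupType) (N : normal_subgroup G) :=
  isUMagmaMorphism.Build G (quotient_group N) (@to_quotient G N)
    (multiplicative1 (@to_quotientM G N), @to_quotientM G N).

Lemma to_quotient1P (G : groupType) (N : normal_subgroup G) x :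
  to_quotient N x = 1 <-> normal_carrier N x.
Proof.
have <- : to_quotient N 1 = 1 := gmulf1.
by split=> [/esym/to_quotientP|Nx]; last apply/esym/to_quotientP;
  rewrite invg1 mul1g.
Qed.

Section LowerCentral.
Variable G : groupType.
Implicit Types (x y z : G) (i j k : nat).
Local Notation gam := (lower_central G).

(** Congruences modulo [gam k] are handled as equalities between images under
    this projection, so that they can be rewritten with. *)
Definition qg k : G -> quotient_group (NormalSubgroup (lower_central_normal G k)) :=
  to_quotient (NormalSubgroup (lower_central_normal G k)).
HB.instance Definition _ k := UMagmaMorphism.on (qg k).

Lemma gam_subgroup k : is_subgroup (gam k).
Proof. by case: (lower_central_normal G k). Qed.

Lemma gam1 k : gam k 1. Proof. by case: (gam_subgroup k). Qed.
Lemma gamM k x y : gam k x -> gam k y -> gam k (x * y).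
Proof. by case: (gam_subgroup k) => _ M _; exact: M. Qed.
Lemma gamV k x : gam k x -> gam k x^-1.
Proof. by case: (gam_subgroup k) => _ _; exact. Qed.
Lemma gamJ k x y : gam k x -> gam k (x ^ y).
Proof. by case: (lower_central_normal G k) => _; exact. Qed.
Lemma gamX k x e : gam k x -> gam k (x ^+ e).
Proof. exact: subgroupX (gam_subgroup k). Qed.

Lemma qgM k x y : qg k (x * y) = qg k x * qg k y. Proof. exact: gmulfM. Qed.
Lemma qg1 k : qg k 1 = 1. Proof. exact: gmulf1. Qed.
Lemma qgV k x : qg k x^-1 = (qg k x)^-1. Proof. exact: gmulfV. Qed.

Lemma qg1P k x : qg k x = 1 <-> gam k x.
Proof. exact: to_quotient1P. Qed.

Lemma qgP k x y : qg k x = qg k y <-> gam k (x^-1 * y).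
Proof. exact: to_quotientP. Qed.

Lemma gamR_self i x y : gam i x -> gam i [~ x, y].
Proof. by move=> xi; rewrite commgEl; apply: gamM; [exact: gamV|exact: gamJ]. Qed.

Lemma gamRS i x y : gam i x -> gam i.+1 [~ x, y].
Proof.
case: i => [//|i] xi.
by apply: generated_mem; exists (x, y).
Qed.

Lemma gamS i x : gam i.+1 x -> gam i x.
Proof.
case: i => [//|i]; apply: (generated_ind (gam_subgroup i.+1)).
by move=> _ [[y z] [/= yi _] <-]; exact: (@gamR_self i.+1).
Qed.

Lemma gam_le i j x : (i <= j)%N -> gam j x -> gam i x.
Proof. by move/subnK <-; elim: (j - i)%N => [//|d IH] /gamS. Qed.

Lemma commgMl x y z : [~ x * y, z] = [~ x, z] ^ y * [~ y, z].
Proof. by rewrite !commgEl !conjgE !invgM !mulgA !(mulgK, mulgVK). Qed.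

Lemma commgMr x y z : [~ x, y * z] = [~ x, z] * [~ x, y] ^ z.
Proof. by rewrite !commgEl !conjgE !invgM !mulgA !(mulgK, mulgVK). Qed.

Lemma commgVr x y : [~ x, y^-1] = ([~ x, y] ^ y^-1)^-1.
Proof.
have := commgMr x y y^-1; rewrite mulgV commg1 => /esym/mulg1_eq <-.
by rewrite invgK.
Qed.

Lemma commgVl x y : [~ x^-1, y] = ([~ x, y] ^ x^-1)^-1.
Proof. by rewrite -invgR commgVr -conjVg invgR. Qed.

Lemma qgJ k x y : gam k x -> qg k.+1 (x ^ y) = qg k.+1 x.
Proof.
move=> xk; apply/esym/qgP; rewrite -commgEl; exact: gamRS.
Qed.

Lemma qgC k x y : gam k x -> qg k.+1 x * qg k.+1 y = qg k.+1 y * qg k.+1 x.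
Proof. by move=> xk; rewrite -!qgM (conjgC x y) [LHS]qgM qgJ // -qgM. Qed.

(** The step from [y] to [[~ y, a]] writes the latter as [y^-1 * y ^ a]: modulo the
    next term, conjugation by [a] does not change [[~ x, y]], so the two factors
    contribute commutators that cancel. *)
Lemma gamR i j x y : gam i x -> gam j y -> gam (i + j) [~ x, y].
Proof.
elim: j i x y => [|j IH] i x y; first by rewrite addn0 => xi _; exact: gamR_self.
case: j IH => [|j] IH xi; first by rewrite addn1 => _; exact: gamRS.
move: y; apply: generated_ind.
  split=> [|y z yi zi|y yi]; first by rewrite commg1; exact: gam1.
    by rewrite commgMr; apply: gamM => //; exact: gamJ.
  by rewrite commgVr; apply: gamV; exact: gamJ.
move=> _ [[y a] [/= yj _] <-].
have cxy : gam (i + j.+1) [~ x, y] by exact: IH.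
have cxV : gam (i + j.+1) [~ x, y^-1] by apply: IH => //; exact: gamV.
rewrite addnS; apply/qg1P.
rewrite {1}[[~ y, a]]commgEl commgMr qgM (qgJ _ cxV).
have -> : [~ x, y ^ a] = [~ x * [~ x, a^-1], y] ^ a.
  by rewrite (commgEl x) mulVKg conjRg -conjgM mulVg conjg1.
have w1 : gam (i + j.+1).+1 [~ [~ x, a^-1], y].
  by rewrite -addSn; apply: IH => //; exact: gamRS.
have -> : qg (i + j.+1).+1 ([~ x * [~ x, a^-1], y] ^ a) = qg (i + j.+1).+1 [~ x, y].
  rewrite commgMl conjMg qgM qgJ; last exact: gamJ.
  by rewrite qgJ // (iffRL (qg1P _ _) (gamJ a w1)) mulg1.
by rewrite -(qgJ y cxV) -qgM -commgMr mulVg commg1 qg1.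
Qed.

Lemma gamR' n i j x y : (n <= i + j)%N -> gam i x -> gam j y -> gam n [~ x, y].
Proof. by move=> le xi yj; apply: gam_le le _; exact: gamR. Qed.

(** Expanding [[~ x * x', y]] only introduces a conjugate of an element of
    [gam (i + j)], and conjugation is invisible one degree higher. This and the next
    three lemmas make commutators bilinear on the graded pieces. *)
Lemma qgRMl n i j x x' y : n = (i + j)%N -> gam i x -> gam j y ->
  qg n.+1 [~ x * x', y] = qg n.+1 [~ x, y] * qg n.+1 [~ x', y].
Proof. by move=> -> xi yj; rewrite commgMl qgM qgJ //; exact: gamR. Qed.

Lemma qgRMr n i j x y y' : n = (i + j)%N -> gam i x -> gam j y ->
  qg n.+1 [~ x, y * y'] = qg n.+1 [~ x, y] * qg n.+1 [~ x, y'].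
Proof.
move=> -> xi yj; rewrite commgMr qgM qgJ; last exact: gamR.
by rewrite (qgC _ (gamR xi yj)).
Qed.

Lemma qgRVl n i j x y : n = (i + j)%N -> gam i x -> gam j y ->
  qg n.+1 [~ x^-1, y] = (qg n.+1 [~ x, y])^-1.
Proof. by move=> -> xi yj; rewrite commgVl qgV qgJ //; exact: gamR. Qed.

Lemma qgRVr n i j x y : n = (i + j)%N -> gam i x -> gam j y ->
  qg n.+1 [~ x, y^-1] = (qg n.+1 [~ x, y])^-1.
Proof. by move=> -> xi yj; rewrite commgVr qgV qgJ //; exact: gamR. Qed.

(** Jacobi's identity, obtained by expanding both sides of
    [[~ x, y] ^ a = [~ x * [~ x, a], y * [~ y, a]]] by bilinearity. *)
Lemma qg_jacobi n i j d x y a : n = (i + j + d)%N ->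
    (0 < i)%N -> (0 < j)%N -> (0 < d)%N -> gam i x -> gam j y -> gam d a ->
  qg n.+1 [~ [~ x, y], a] = qg n.+1 [~ [~ x, a], y] * qg n.+1 [~ x, [~ y, a]].
Proof.
move=> -> i0 j0 d0 xi yj ad.
set u := [~ x, a]; set v := [~ y, a]; set q := qg _.
have qM s t : q (s * t) = q s * q t by exact: qgM.
have q1 : q 1 = 1 by exact: qg1.
have ui : gam (i + d) u by exact: gamR.
have vj : gam (j + d) v by exact: gamR.
have xyJ : [~ x, y] ^ a = [~ x * u, y * v].
  by rewrite conjRg !commgEl !mulVKg.
have small z : gam (i + j + d).+1 z -> q z = 1 by move/qg1P.
have qJ s t : gam (i + j + d) s -> q (s ^ t) = q s by exact: qgJ.
have qxy s : (0 < s)%N -> forall t, gam (s + d) t -> q ([~ x, y] ^ t) = q [~ x, y].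
  move=> s0 t st; rewrite -[_ ^ t](mulVKg [~ x, y]) qM -commgEl.
  rewrite (small [~ [~ x, y], t]) ?mulg1 //; apply: (@gamR' _ (i + j) (s + d)) => //.
    by rewrite addnA -addSn leq_add2r -addn1 leq_add2l.
  exact: gamR.
have : q ([~ x, y] ^ a) = q [~ x, v] * (q [~ x, y] * q [~ u, y]).
  rewrite xyJ commgMl qM commgMr.
  rewrite conjMg (qM (_ ^ _)) -conjgM qJ; last first.
    by apply: (@gamR' _ i (j + d)); rewrite ?addnA.
  rewrite (conjgM _ v u).
  have -> : q (([~ x, y] ^ v) ^ u) = q [~ x, y].
    rewrite -conjgM; apply: (qxy 1%N) => //.
    apply: gamM.
      by apply: gam_le vj; rewrite leq_add2r.
    by apply: gam_le ui; rewrite leq_add2r.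
  rewrite (commgMr u) (qM [~ u, v]) [q ([~ u, y] ^ v)]qJ; last first.
    by apply: (@gamR' _ (i + d) j); rewrite // addnAC.
  rewrite (small [~ u, v]) ?mul1g ?mulgA //.
  apply: (@gamR' _ (i + d) (j + d)) => //.
  by lia.
rewrite -[[~ x, y] ^ a](mulVKg [~ x, y]) -commgEl qM => H.
have cc : q [~ x, v] * q [~ x, y] = q [~ x, y] * q [~ x, v].
  by apply: qgC; rewrite -addnA; exact: gamR.
move: H; rewrite mulgA cc -mulgA => /mulgI ->.
by apply: qgC; rewrite -addnA; exact: gamR.
Qed.

End LowerCentral.

(** The lower central series descends at least as fast as any series [K] such that
    commutators of [K k] with [K 1] lie in [K k.+1]. *)
Lemma gam_morph (G H : groupType) (f : G -> H) (K : nat -> set H) :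
  {morph f : x y / x * y} -> (forall k, is_subgroup (K k)) ->
  (forall k x y, K k.+1 x -> K 1%N y -> K k.+2 [~ x, y]) ->
  (forall x, K 1%N (f x)) ->
  forall k x, (0 < k)%N -> lower_central G k x -> K k (f x).
Proof.
move=> fM sK KR K1; have f1 := multiplicative1 fM.
have fV x : f x^-1 = (f x)^-1.
  by apply/esym/mulg1_eq; rewrite -fM mulgV f1.
case=> [//|k] x _; elim: k x => [|k IH] x; first by move=> _; exact: K1.
apply: (@generated_ind _ _ [set x | K k.+2 (f x)]).
  have [s1 sM sV] := sK k.+2.
  by split=> [|y z|y] /=; rewrite ?f1 ?fM ?fV //; [exact: sM|exact: sV].
move=> _ [[y z] [/= yk _] <-] /=.
rewrite !commgEl !conjgE !(fM, fV) -conjgE -commgEl.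
by apply: KR; [exact: IH|exact: K1].
Qed.

(** * Words and homomorphisms from free groups *)

Section WordEval.
Variables (n : nat) (H : groupType) (u : 'I_n -> H).

Definition letter_eval (l : 'I_n * bool) : H :=
  if l.2 then (u l.1)^-1 else u l.1.

Definition word_eval (w : word n) : H := \prod_(l <- w) letter_eval l.

Lemma word_eval_cat v w : word_eval (v ++ w) = word_eval v * word_eval w.
Proof. exact: big_cat. Qed.

Lemma word_eval_cons l w : word_eval (l :: w) = letter_eval l * word_eval w.
Proof. exact: big_cons. Qed.

Lemma word_eval_equiv v w : free_equiv v w -> word_eval v = word_eval w.
Proof.
elim=> {v w} [//|v w _ -> //|v x w _ -> _ -> //|v w [i b]].
rewrite !word_eval_cat !word_eval_cons; congr (_ * _).
by rewrite /letter_eval /=; case: b; rewrite /= ?mulVKg ?mulKg.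
Qed.

Definition free_lift (x : free_group n) : H := word_eval (repr x).

Lemma free_liftE w : free_lift (free_of_word w) = word_eval w.
Proof. by apply/word_eval_equiv/free_of_wordP; rewrite /free_of_word reprK. Qed.
End WordEval.

Lemma free_wordW n (P : free_group n -> Prop) :
  (forall w, P (free_of_word w)) -> forall x, P x.
Proof. by move=> Pw x; rewrite -[x]reprK; exact: Pw. Qed.

Lemma free_liftM n (H : groupType) (u : 'I_n -> H) :
  {morph free_lift u : x y / x * y}.
Proof.
by elim/free_wordW=> v; elim/free_wordW=> w;
  rewrite -free_of_wordM !free_liftE word_eval_cat.
Qed.

HB.instance Definition _ n (H : groupType) (u : 'I_n -> H) :=
  isUMagmaMorphism.Build (free_group n) H (free_lift u)
    (multiplicative1 (free_liftM u), free_liftM u).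

Definition free_gen n (j : 'I_n) : free_group n := free_of_word [:: (j, false)].

Lemma free_lift_gen n (H : groupType) (u : 'I_n -> H) j :
  free_lift u (free_gen j) = u j.
Proof. by rewrite free_liftE /word_eval big_seq1. Qed.

Lemma free_of_word_eval n (w : word n) : free_of_word w = word_eval (@free_gen n) w.
Proof.
elim: w => [|[j b] w IH]; first by rewrite /word_eval big_nil.
rewrite word_eval_cons -IH -cat1s free_of_wordM; congr (_ * _).
rewrite /letter_eval /=; case: b => //.
apply/esym/mulg1_eq; rewrite -free_of_wordM; apply/free_of_wordP.
exact: (FreeCancel [::] [::] (j, false)).
Qed.

Lemma morph_word_eval n (G H : groupType) (f : G -> H) (u : 'I_n -> G) w :
  {morph f : x y / x * y} -> f (word_eval u w) = word_eval (f \o u) w.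
Proof.
move=> fM; have f1 := multiplicative1 fM.
elim: w => [|[j b] w IH]; first by rewrite /word_eval !big_nil.
rewrite !word_eval_cons fM IH; congr (_ * _).
rewrite /letter_eval /=; case: b => //=.
by apply/esym/mulg1_eq; rewrite -fM mulgV.
Qed.

Lemma word_eval_subgroup n (G : groupType) (H : set G) (u : 'I_n -> G) w :
  is_subgroup H -> (forall j, H (u j)) -> H (word_eval u w).
Proof.
move=> [H1 HM HV] Hu; rewrite /word_eval.
elim/big_rec: _ => // -[j b] x _ Hx; apply: HM Hx.
by rewrite /letter_eval /=; case: b; [exact: HV|].
Qed.

Lemma free_gen_ind n (H : set (free_group n)) :
  is_subgroup H -> (forall j, H (free_gen j)) -> forall x, H x.
Proof.
move=> sH Hg; elim/free_wordW=> w; rewrite free_of_word_eval.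
exact: word_eval_subgroup.
Qed.

Lemma free_morph_ext n (H : groupType) (f g : free_group n -> H) :
  {morph f : x y / x * y} -> {morph g : x y / x * y} ->
  (forall j, f (free_gen j) = g (free_gen j)) -> f =1 g.
Proof.
move=> fM gM fg; elim/free_wordW=> w; rewrite free_of_word_eval.
rewrite !morph_word_eval //; apply: eq_bigr => -[j b] _.
by rewrite /letter_eval /= fg.
Qed.

(** * Endomorphism rings and their unit groups *)

Section Endo.
Local Open Scope ring_scope.
Variable V : zmodType.

(** Asking additivity for differences covers sums, opposites and zero in a single
    axiom. *)
Record endo := Endo {
  endo_fun :> V -> V;
  endoB : forall x y, endo_fun (x - y) = endo_fun x - endo_fun y }.

HB.instance Definition _ := gen_eqMixin endo.
HB.instance Definition _ := gen_choiceMixin endo.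

Lemma endoP (f g : endo) : f =1 g -> f = g.
Proof.
case: f g => [f Bf] [g Bg] /= /funext fg; move: Bf Bg; rewrite fg => Bf Bg.
by congr Endo; exact: Prop_irrelevance.
Qed.

Lemma endo0 (f : endo) : f 0 = 0.
Proof. by have := endoB f 0 0; rewrite !subrr. Qed.
Lemma endoN (f : endo) x : f (- x) = - f x.
Proof. by rewrite -[in LHS](sub0r x) endoB endo0 sub0r. Qed.
Lemma endoD (f : endo) x y : f (x + y) = f x + f y.
Proof. by rewrite -{1}[y]opprK endoB endoN opprK. Qed.

Fact endo_zero_subproof (x y : V) : (0 : V) = 0 - 0. Proof. by rewrite subrr. Qed.
Definition endo_zero := @Endo (fun=> 0) endo_zero_subproof.
Definition endo_one := @Endo id (fun x y => erefl).
Fact endo_opp_subproof (f : endo) x y : - f (x - y) = - f x - (- f y).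
Proof. by rewrite endoB opprB opprK addrC. Qed.
Definition endo_opp f := Endo (endo_opp_subproof f).
Fact endo_add_subproof (f g : endo) x y :
  f (x - y) + g (x - y) = (f x + g x) - (f y + g y).
Proof. by rewrite !endoB opprD addrACA. Qed.
Definition endo_add f g := Endo (endo_add_subproof f g).
Fact endo_mul_subproof (f g : endo) x y : f (g (x - y)) = f (g x) - f (g y).
Proof. by rewrite !endoB. Qed.
Definition endo_mul f g := Endo (endo_mul_subproof f g).

Fact endo_addA : associative endo_add.
Proof. by move=> f g h; apply: endoP => x /=; rewrite addrA. Qed.
Fact endo_addC : commutative endo_add.
Proof. by move=> f g; apply: endoP => x /=; rewrite addrC. Qed.
Fact endo_add0 : left_id endo_zero endo_add.
Proof. by move=> f; apply: endoP => x /=; rewrite add0r. Qed.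
Fact endo_addN : left_inverse endo_zero endo_opp endo_add.
Proof. by move=> f; apply: endoP => x /=; rewrite addNr. Qed.
HB.instance Definition _ :=
  GRing.isZmodule.Build endo endo_addA endo_addC endo_add0 endo_addN.

Fact endo_mulA : associative endo_mul.
Proof. by move=> f g h; apply: endoP. Qed.
Fact endo_mul1 : left_id endo_one endo_mul.
Proof. by move=> f; apply: endoP. Qed.
Fact endo_mulr1 : right_id endo_one endo_mul.
Proof. by move=> f; apply: endoP. Qed.
Fact endo_mulDl : left_distributive endo_mul endo_add.
Proof. by move=> f g h; apply: endoP. Qed.
Fact endo_mulDr : right_distributive endo_mul endo_add.
Proof. by move=> f g h; apply: endoP => x /=; rewrite endoD. Qed.
HB.instance Definition _ := GRing.Zmodule_isPzRing.Build endo
  endo_mulA endo_mul1 endo_mulr1 endo_mulDl endo_mulDr.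

Lemma endoE_add (f g : endo) x : (f + g) x = f x + g x. Proof. by []. Qed.
Lemma endoE_opp (f : endo) x : (- f) x = - f x. Proof. by []. Qed.
Lemma endoE_mul (f g : endo) x : (f * g) x = f (g x). Proof. by []. Qed.
Lemma endoE_one x : (1 : endo) x = x. Proof. by []. Qed.
Lemma endoE_zero x : (0 : endo) x = 0. Proof. by []. Qed.
Definition endoE := (endoE_add, endoE_opp, endoE_mul, endoE_one, endoE_zero).
End Endo.

Section UnitGroup.
Variable S : pzRingType.

(** The inverse is part of the data, so that it can be computed with; [unitsP]
    makes it irrelevant for equality. *)
Record units := Units {
  uval : S; uinv : S;
  uinvK : (uinv * uval = 1)%R; uvalK : (uval * uinv = 1)%R }.

HB.instance Definition _ := gen_eqMixin units.
HB.instance Definition _ := gen_choiceMixin units.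

Lemma unitsP (u v : units) : uval u = uval v -> u = v.
Proof.
case: u v => [u u' uu u'u] [v v' vv v'v] /= uv; subst v.
have e : u' = v' by rewrite -[u']mulr1 -v'v mulrA uu mul1r.
by subst v'; congr Units; exact: Prop_irrelevance.
Qed.

Fact units_one_subproof : (1 * 1 = 1 :> S)%R. Proof. by rewrite mulr1. Qed.
Definition units_one := Units units_one_subproof units_one_subproof.
Definition units_inv u := Units (uvalK u) (uinvK u).
Fact units_mul_subproof1 u v : (uinv v * uinv u * (uval u * uval v) = 1)%R.
Proof. by rewrite mulrA -(mulrA (uinv v)) uinvK mulr1 uinvK. Qed.
Fact units_mul_subproof2 u v : (uval u * uval v * (uinv v * uinv u) = 1)%R.
Proof. by rewrite mulrA -(mulrA (uval u)) uvalK mulr1 uvalK. Qed.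
Definition units_mul u v :=
  Units (units_mul_subproof1 u v) (units_mul_subproof2 u v).

Fact units_mulA : associative units_mul.
Proof. by move=> u v w; apply: unitsP => /=; rewrite mulrA. Qed.
Fact units_mul1 : left_id units_one units_mul.
Proof. by move=> u; apply: unitsP => /=; rewrite mul1r. Qed.
Fact units_mulr1 : right_id units_one units_mul.
Proof. by move=> u; apply: unitsP => /=; rewrite mulr1. Qed.
Fact units_mulV : left_inverse units_one units_inv units_mul.
Proof. by move=> u; apply: unitsP => /=; rewrite uinvK. Qed.
Fact units_mulrV : right_inverse units_one units_inv units_mul.
Proof. by move=> u; apply: unitsP => /=; rewrite uvalK. Qed.
HB.instance Definition _ := isGroup.Build units
  units_mulA units_mul1 units_mulr1 units_mulV units_mulrV.

Lemma uvalM u v : uval (u * v) = (uval u * uval v)%R. Proof. by []. Qed.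
Lemma uvalV u : uval u^-1 = uinv u. Proof. by []. Qed.
End UnitGroup.

(** * Unipotent power-series operators *)

Section Series.
Local Open Scope ring_scope.
Variable V : zmodType.
Local Notation W := (nat -> V).
Implicit Types (f g : endo W) (u v : units (endo W)) (l : endo V) (w : W).

Lemma seqD w w' i : (w + w') i = w i + w' i. Proof. by []. Qed.
Lemma seqN w i : (- w) i = - w i. Proof. by []. Qed.

(** A sequence stands for the power series in [z] with these coefficients, and
    [zshift] for the multiplication by [z]. *)
Definition zshift w : W := fun n => if n is n'.+1 then w n' else 0.

(** Commuting with [z] makes an operator a power series in [z] whose coefficients
    are endomorphisms of [V]. *)
Definition homog f := forall w, f (zshift w) = zshift (f w).

(** Operators of the form [z ^ k * h] with [h] a power series. *)
Definition ord_ge k f := homog f /\ forall w i, (i < k)%N -> f w i = 0.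

Lemma homog_iter f k w : homog f -> f (iter k zshift w) = iter k zshift (f w).
Proof. by move=> hf; elim: k => [//|k IH]; rewrite !iterS hf IH. Qed.

Lemma iter_zshiftE k w i :
  iter k zshift w i = if (i < k)%N then 0 else w (i - k)%N.
Proof.
elim: k i => [|k IH] i /=; first by rewrite subn0.
by case: i => [//|i]; rewrite /= IH.
Qed.

Lemma vanish_iter k w : (forall i, (i < k)%N -> w i = 0) ->
  w = iter k zshift (fun i => w (i + k)%N).
Proof.
move=> w0; apply/funext => i; rewrite iter_zshiftE.
by case: ltnP => [/w0 //|ki]; rewrite subnK.
Qed.

Lemma homogM f g : homog f -> homog g -> homog (f * g).
Proof. by move=> hf hg w; rewrite /= hg hf. Qed.

Lemma zshiftD w w' : zshift (w + w') = zshift w + zshift w'.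
Proof. by apply/funext => -[|i] //=; rewrite !seqD /= addr0. Qed.
Lemma zshiftN w : zshift (- w) = - zshift w.
Proof. by apply/funext => -[|i] //=; rewrite !seqN /= oppr0. Qed.

Lemma homogD f g : homog f -> homog g -> homog (f + g).
Proof. by move=> hf hg w; rewrite !endoE hf hg zshiftD. Qed.
Lemma homogN f : homog f -> homog (- f).
Proof. by move=> hf w; rewrite !endoE hf zshiftN. Qed.

Lemma ord_geD k f g : ord_ge k f -> ord_ge k g -> ord_ge k (f + g).
Proof.
move=> [hf f0] [hg g0]; split; first exact: homogD.
by move=> w i ik; rewrite endoE_add seqD f0 // g0 // addr0.
Qed.
Lemma ord_geN k f : ord_ge k f -> ord_ge k (- f).
Proof.
move=> [hf f0]; split; first exact: homogN.
by move=> w i ik; rewrite endoE_opp seqN f0 // oppr0.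
Qed.
Lemma ord_geB k f g : ord_ge k f -> ord_ge k g -> ord_ge k (f - g).
Proof. by move=> kf kg; apply: ord_geD => //; exact: ord_geN. Qed.
Lemma ord_ge_zero k : ord_ge k 0.
Proof. by split=> // w; apply/funext => -[]. Qed.
Lemma ord_ge_le i j f : (i <= j)%N -> ord_ge j f -> ord_ge i f.
Proof.
by move=> ij [hf f0]; split=> // w k ki; apply: f0; exact: leq_trans ki ij.
Qed.

Lemma ord_geM i j f g : ord_ge i f -> ord_ge j g -> ord_ge (i + j) (f * g).
Proof.
move=> [hf f0] [hg g0]; split; first exact: homogM.
move=> w k kij; rewrite /= (vanish_iter (g0 w)) homog_iter // iter_zshiftE.
by case: ltnP => // jk; rewrite f0 // ltn_subLR // addnC.
Qed.

Lemma ord_geX k f n : ord_ge k f -> ord_ge (n * k) (f ^+ n).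
Proof.
move=> kf; elim: n => [|n IH]; first by rewrite expr0.
by rewrite exprS mulSn; exact: ord_geM.
Qed.

(** [lead k f l]: the coefficient of [z ^ k] in [f] is [l], and the lower ones
    vanish. *)
Definition lead k f l := ord_ge k f /\ forall w, f w k = l (w 0%N).

Definition const0 (x : V) : W := fun n => if n is 0 then x else 0.

Lemma const0B x y : const0 (x - y) = const0 x - const0 y.
Proof. by apply/funext => -[|i] //; rewrite seqD seqN /= subrr. Qed.

(** A series differs from its constant term by a multiple of [z], to which [f]
    contributes only in degrees above [k]. *)
Lemma lead_ex k f : ord_ge k f -> exists l, lead k f l.
Proof.
move=> kf; have [hf f0] := kf.
have lB x y : f (const0 (x - y)) k = f (const0 x) k - f (const0 y) k.
  by rewrite const0B endoB.
exists (Endo lB); split=> // w /=.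
have {1}-> : w = const0 (w 0%N) + zshift (fun i => w i.+1).
  by apply/funext => -[|i]; rewrite seqD /= ?addr0 ?add0r.
rewrite endoD hf seqD.
suff -> : zshift (f (fun i => w i.+1)) k = 0 by rewrite addr0.
by case: k f0 {kf lB} => [//|k] f0 /=; exact: f0.
Qed.

Lemma lead_uniq k f l l' : lead k f l -> lead k f l' -> l = l'.
Proof.
move=> [_ fl] [_ fl']; apply: endoP => x.
by rewrite -[x]/(const0 x 0%N) -fl fl'.
Qed.

Lemma lead0P k f : lead k f 0 <-> ord_ge k.+1 f.
Proof.
split=> [[[hf f0] fk]|kf].
  split=> // w i; rewrite ltnS leq_eqVlt => /orP[/eqP->|]; last exact: f0.
  by rewrite fk.
split; first exact: ord_ge_le kf.
by move=> w; rewrite (kf.2 w k (ltnSn k)).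
Qed.

Lemma leadD k f g l l' : lead k f l -> lead k g l' -> lead k (f + g) (l + l').
Proof.
move=> [kf fl] [kg gl]; split; first exact: ord_geD.
by move=> w; rewrite endoE_add seqD fl gl.
Qed.
Lemma leadN k f l : lead k f l -> lead k (- f) (- l).
Proof.
move=> [kf fl]; split; first exact: ord_geN.
by move=> w; rewrite endoE_opp seqN fl.
Qed.
Lemma leadM i j f g l l' : lead i f l -> lead j g l' -> lead (i + j) (f * g) (l * l').
Proof.
move=> [fi fl] [gj gl]; split; first exact: ord_geM.
move=> w; have [hf _] := fi; have [_ g0] := gj.
rewrite endoE (vanish_iter (g0 w)) homog_iter // iter_zshiftE.
by rewrite ltnNge leq_addl /= addnK fl add0n gl.
Qed.

Lemma lead_one : lead 0 1 1. Proof. by []. Qed.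
Lemma lead_zero k : lead k 0 0. Proof. by apply/lead0P/ord_ge_zero. Qed.

(** The filtration of the unit group: [u = 1 + O(z ^ k)]. *)
Definition Ufilt k u := ord_ge k (uval u - 1).

Lemma Ufilt_homog k u : Ufilt k u -> homog (uval u).
Proof. by case=> hu _; rewrite -[uval u](subrK 1); exact: homogD. Qed.

Lemma Ufilt_homogV k u : Ufilt k u -> homog (uinv u).
Proof.
move=> /Ufilt_homog hu w.
rewrite -[RHS](endoE_one (zshift _)) -(uinvK u) endoE_mul hu.
by rewrite -endoE_mul uvalK.
Qed.

Lemma Ufilt_subgroup k : is_subgroup (Ufilt k).
Proof.
split=> [|u v ku kv|u ku].
- by rewrite /Ufilt subrr; exact: ord_ge_zero.
- rewrite /Ufilt uvalM.
  have -> : uval u * uval v - 1 = (uval u - 1) * uval v + (uval v - 1).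
    by rewrite mulrBl mul1r addrA subrK.
  apply: ord_geD => //; rewrite -[k]addn0; apply: ord_geM => //.
  by split=> //; exact: Ufilt_homog kv.
- rewrite /Ufilt uvalV.
  have -> : uinv u - 1 = - ((uval u - 1) * uinv u).
    by rewrite mulrBl uvalK mul1r opprB.
  apply: ord_geN; rewrite -[k]addn0; apply: ord_geM => //.
  by split=> //; exact: Ufilt_homogV ku.
Qed.

Definition ulead k u l := lead k (uval u - 1) l.

Lemma ulead0P k u : ulead k u 0 <-> Ufilt k.+1 u.
Proof. exact: lead0P. Qed.

Lemma ulead_Ufilt k u l : ulead k u l -> Ufilt k u. Proof. by case. Qed.

Lemma Ufilt_le i j u : (i <= j)%N -> Ufilt j u -> Ufilt i u.
Proof. exact: ord_ge_le. Qed.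

Lemma Ufilt_lead1 k u : (0 < k)%N -> Ufilt k u -> lead 0 (uval u) 1.
Proof.
move=> k0 /(Ufilt_le k0) /lead0P /leadD /(_ lead_one).
by rewrite subrK add0r.
Qed.

Lemma ulead1 k : ulead k 1%g 0.
Proof. by rewrite /ulead subrr; exact: lead_zero. Qed.

Lemma uleadM k u v l l' : (0 < k)%N -> ulead k u l -> ulead k v l' ->
  ulead k (u * v)%g (l + l').
Proof.
move=> k0 ul vl; rewrite /ulead uvalM.
have -> : uval u * uval v - 1 = (uval u - 1) * uval v + (uval v - 1).
  by rewrite mulrBl mul1r addrA subrK.
apply: leadD => //; rewrite -[k]addn0 -[l]mulr1; apply: leadM => //.
exact: (Ufilt_lead1 k0 (ulead_Ufilt vl)).
Qed.

Lemma uleadV k u l : (0 < k)%N -> ulead k u l -> ulead k u^-1%g (- l).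
Proof.
move=> k0 ul; rewrite /ulead uvalV.
have -> : uinv u - 1 = - ((uval u - 1) * uinv u).
  by rewrite mulrBl uvalK mul1r opprB.
apply: leadN; rewrite -[k]addn0 -[l]mulr1; apply: leadM => //.
rewrite -uvalV; apply: (Ufilt_lead1 k0).
by have [_ _] := Ufilt_subgroup k; apply; exact: ulead_Ufilt ul.
Qed.

(** Up to a unit factor, a group commutator is a ring commutator. *)
Lemma uvalR u v : uval [~ u, v]%g - 1 =
  uval (v * u)^-1%g *
    ((uval u - 1) * (uval v - 1) - (uval v - 1) * (uval u - 1)).
Proof.
have -> : (uval u - 1) * (uval v - 1) - (uval v - 1) * (uval u - 1) =
    uval (u * v)%g - uval (v * u)%g.
  have e (a b : endo W) : (a - 1) * (b - 1) = a * b - (a + b - 1).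
    by rewrite mulrBl mulrBr mulr1 mul1r -addrA -opprD addrA.
  have s (a b d : endo W) : (a - b) - (d - b) = a - d.
    by rewrite opprB addrA subrK.
  by rewrite !e [uval v + _]addrC s !uvalM.
rewrite mulrBr -!uvalM mulVg; congr (uval _ - _).
by rewrite invgM commgEl conjgE !mulgA.
Qed.

Lemma UfiltR i j u v : (0 < i)%N -> (0 < j)%N ->
  Ufilt i u -> Ufilt j v -> Ufilt (i + j) [~ u, v]%g.
Proof.
move=> i0 j0 ui vj; rewrite /Ufilt uvalR -[(i + j)%N]add0n; apply: ord_geM.
  split=> //; apply: (@Ufilt_homog 1); have [_ M1 V1] := Ufilt_subgroup 1.
  by apply/V1/M1; [exact: Ufilt_le vj|exact: Ufilt_le ui].
by apply: ord_geB; [|rewrite addnC]; exact: ord_geM.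
Qed.

Lemma uleadR i j u v l l' : (0 < i)%N -> (0 < j)%N ->
  ulead i u l -> ulead j v l' -> ulead (i + j) [~ u, v]%g (l * l' - l' * l).
Proof.
move=> i0 j0 ul vl; rewrite /ulead uvalR -[(i + j)%N]add0n -[l * l' - _]mul1r.
apply: leadM.
  have [_ M1 V1] := Ufilt_subgroup 1; apply: (@Ufilt_lead1 1) => //.
  by apply/V1/M1; apply: Ufilt_le (ulead_Ufilt _);
    [exact: j0|exact: vl|exact: i0|exact: ul].
by apply: leadD; [|apply: leadN; rewrite addnC]; exact: leadM.
Qed.

(** The inverse is the geometric series. Its coefficient of degree [n] is already
    right in every partial sum of more than [n] terms, which defines it without
    any notion of convergence. *)
Lemma unipotent_ex f : ord_ge 1 f -> exists u, uval u = 1 + f.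
Proof.
move=> f1.
have fX n : ord_ge n ((- f) ^+ n).
  by have := ord_geX n (ord_geN f1); rewrite muln1.
pose G N : endo W := \sum_(i < N) (- f) ^+ i.
pose g w : W := fun n => G n.+1 w n.
have GN N w n : (n < N)%N -> G N w n = g w n.
  elim: N => [//|N IH]; rewrite ltnS leq_eqVlt => /orP[/eqP->//|nN].
  rewrite /G big_ord_recr endoE_add seqD -/(G N) IH //.
  by rewrite (fX N).2 // addr0.
have gB w w' : g (w - w') = g w - g w'.
  by apply/funext => n; rewrite /g endoB.
have GV N : (1 + f) * G N = 1 - (- f) ^+ N.
  rewrite /G; elim: N => [|N IH]; first by rewrite big_ord0 mulr0 expr0 subrr.
  rewrite big_ord_recr /= mulrDr IH mulrDl mul1r exprS mulNr opprK.
  by rewrite addrA subrK.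
have GC N : G N * (1 + f) = (1 + f) * G N.
  rewrite /G mulr_suml mulr_sumr; apply: eq_bigr => i _.
  rewrite mulrDl mulrDr mul1r mulr1; congr (_ + _).
  by apply/esym/commrX; rewrite /GRing.comm mulrN mulNr.
have h1 : homog (1 + f) by apply: homogD => //; case: f1.
have vg : (1 + f) * Endo gB = 1.
  apply: endoP => w; apply/funext => n.
  have dw : g w - G n.+1 w = iter n.+1 zshift (fun i => (g w - G n.+1 w) (i + n.+1)%N).
    by apply: vanish_iter => i lt; rewrite seqD seqN GN // subrr.
  rewrite endoE_mul [Endo gB w]/= -[g w](subrK (G n.+1 w)) endoD dw.
  rewrite homog_iter // seqD iter_zshiftE ltnSn add0r.
  rewrite -(endoE_mul (1 + f)) GV endoE_add endoE_opp seqD seqN.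
  by rewrite (fX n.+1).2 // oppr0 addr0.
have gv : Endo gB * (1 + f) = 1.
  apply: endoP => w; apply/funext => n.
  rewrite -[LHS]/(G n.+1 ((1 + f) w) n) -endoE_mul GC GV endoE_add endoE_opp seqD seqN.
  by rewrite (fX n.+1).2 // oppr0 addr0.
by exists (Units gv vg).
Qed.

Fact monomial_subproof k l (w w' : W) :
  iter k zshift (l \o (w - w')) = iter k zshift (l \o w) - iter k zshift (l \o w').
Proof.
apply/funext => i; rewrite seqD seqN !iter_zshiftE.
case: ifP => _; first by rewrite subrr.
by rewrite /= -endoB.
Qed.
Definition monomial k l := Endo (monomial_subproof k l).

Lemma lead_monomial k l : lead k (monomial k l) l.
Proof.
split; first split=> [w|w i ik] /=.
- rewrite -iterS iterSr; congr (iter _ _ _).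
  by apply/funext => -[|i] //=; rewrite endo0.
- by rewrite iter_zshiftE ik.
- by move=> w /=; rewrite iter_zshiftE ltnn subnn.
Qed.

Lemma ulead_surj k l : (0 < k)%N -> exists u, ulead k u l.
Proof.
move=> k0; have lm := lead_monomial k l.
have [u uE] := unipotent_ex (ord_ge_le k0 lm.1).
by exists u; rewrite /ulead uE addrC addKr.
Qed.
End Series.

(** * Lazard elimination in the graded Lie ring of a group *)

Section IntegerPowers.
Variable G : groupType.
Implicit Types (x y : G) (e f : int).

Definition zpow x e : G :=
  match e with Posz n => x ^+ n | Negz n => x ^- n.+1 end.

Lemma zpow0 x : zpow x 0 = 1. Proof. exact: expg0. Qed.
Lemma zpow1 x : zpow x 1 = x. Proof. exact: expg1. Qed.

Lemma zpowB x (p q : nat) : zpow x (p%:Z - q%:Z)%R = x ^+ p * x ^- q.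
Proof.
case: (leqP q p) => [qp|/ltnW pq].
  by rewrite subzn // /= expgnFr.
rewrite -opprB subzn // -invgF -expgnFr //.
by case: (q - p)%N => [|r]; rewrite ?oppr0 /= ?invg1.
Qed.

Lemma int_diff e : exists p q : nat, e = (p%:Z - q%:Z)%R.
Proof.
by case: e => n; [exists n, 0%N; rewrite subr0|exists 0%N, n.+1; rewrite sub0r NegzE].
Qed.

Lemma zpowD x e f : zpow x (e + f)%R = zpow x e * zpow x f.
Proof.
have [p [q ->]] := int_diff e; have [p' [q' ->]] := int_diff f.
rewrite addrACA -opprD -!PoszD !zpowB !expgnDr invgM -!mulgA; congr (_ * _).
have C (i j : nat) : x ^+ i * x ^- j = x ^- j * x ^+ i.
  by apply/commuteV/commuteX2.
by rewrite [RHS]mulgA -C -[RHS]mulgA; congr (_ * _); rewrite -!invgM -!expgnDr addnC.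
Qed.

Lemma zpowN x e : zpow x (- e)%R = (zpow x e)^-1.
Proof. by apply/esym/mulg1_eq; rewrite -zpowD subrr zpow0. Qed.

Lemma zpow_subgroup (H : set G) x e : is_subgroup H -> H x -> H (zpow x e).
Proof.
move=> sH Hx; have [_ _ HV] := sH.
by case: e => k; [|apply: HV]; exact: subgroupX.
Qed.

Lemma zpowC x e f : zpow x e * zpow x f = zpow x f * zpow x e.
Proof. by rewrite -!zpowD addrC. Qed.

Lemma zpowR x e f : [~ zpow x e, zpow x f] = 1.
Proof. by apply/eqP/commgP; exact: zpowC. Qed.
End IntegerPowers.

Section GradedLie.
Variable G : groupType.
Local Notation gam := (lower_central G).

Section Def.
Variables (X : Type) (w : X -> nat) (g : X -> G).

(** [lie k x] says that the class of [x] in the quotient of [gam k] by [gam k.+1]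
    belongs to the graded Lie subring generated by the classes of the [g x] in
    degrees [w x]. Working with representatives instead of classes requires the
    constructor [LieLow]. *)
Inductive lie : nat -> G -> Prop :=
| LieGen x : lie (w x) (g x)
| LieM k x y : lie k x -> lie k y -> lie k (x * y)
| LieV k x : lie k x -> lie k x^-1
| LieR i j x y : lie i x -> lie j y -> lie (i + j) [~ x, y]
| LieLow k x : (0 < k)%N -> gam k.+1 x -> lie k x.

Hypothesis w_gt0 : forall x, (0 < w x)%N.
Hypothesis gamg : forall x, gam (w x) (g x).

Lemma lie_gt0 k x : lie k x -> (0 < k)%N.
Proof. by elim=> // i j _ _ _ i0 _ _; rewrite addn_gt0 i0. Qed.

Lemma lie_gam k x : lie k x -> gam k x.
Proof.
elim=> {k x} [x|k x y _ + _|k x _|i j x y _ + _|k x _] //.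
- exact: gamM.
- exact: gamV.
- exact: gamR.
- exact: gamS.
Qed.

Lemma lie1 k : (0 < k)%N -> lie k 1.
Proof. by move=> k0; apply: LieLow => //; exact: gam1. Qed.

Lemma lie_cong k x y : qg k.+1 x = qg k.+1 y -> lie k x -> lie k y.
Proof.
move=> /qgP xy lx; rewrite -[y](mulVKg x).
by apply: LieM => //; apply: LieLow => //; exact: lie_gt0 lx.
Qed.
End Def.

Section Elimination.
Variables (c : nat) (X : finType) (w : X -> nat) (g : X -> G) (a : X).
Hypothesis w_gt0 : forall x, (0 < w x)%N.
Hypothesis gamg : forall x, gam (w x) (g x).

(** The letter [(b, i)] stands for [b] bracketed [i] times with [a]. In weights up
    to [c] only the values [i <= c] matter, which keeps the family finite. *)
Definition elim_type : finType := ({x : X | x != a} * 'I_c.+1)%type.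
Definition elim_weight (y : elim_type) : nat := (w (val y.1) + y.2 * w a)%N.
Definition ad_iter i (x : G) : G := iter i (fun z => [~ z, g a]) x.
Definition elim_gen (y : elim_type) : G := ad_iter y.2 (g (val y.1)).

Lemma elim_weight_gt0 y : (0 < elim_weight y)%N.
Proof. by rewrite addn_gt0 w_gt0. Qed.

Lemma gam_ad_iter k i x : gam k x -> gam (k + i * w a) (ad_iter i x).
Proof.
move=> xk; elim: i => [|i IH]; first by rewrite addn0.
rewrite mulSn addnCA addnC; exact: gamR.
Qed.

Lemma gam_elim_gen y : gam (elim_weight y) (elim_gen y).
Proof. exact: gam_ad_iter. Qed.

Local Notation lie' := (lie elim_weight elim_gen).

Let gam' k x : lie' k x -> gam k x.
Proof. by apply: lie_gam; exact: gam_elim_gen. Qed.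
Let gt0' k x : lie' k x -> (0 < k)%N.
Proof. by apply: lie_gt0; exact: elim_weight_gt0. Qed.
Let cong' k x y : qg k.+1 x = qg k.+1 y -> lie' k x -> lie' k y.
Proof. by apply: lie_cong; exact: elim_weight_gt0. Qed.

(** By Jacobi's identity, the Lie ring of the new letters is stable under
    bracketing with the removed letter. *)
Lemma lie_ad k x : lie' k x -> (k + w a <= c)%N -> lie' (k + w a) [~ x, g a].
Proof.
elim=> {k x} [[b i]|k x y lx IHx ly IHy|k x lx IH|i j x y lx IHx ly IHy|k x k0 xk] kc.
- have ic : (i.+1 < c.+1)%N.
    rewrite ltnS; apply: leq_trans kc; rewrite /elim_weight /=.
    have := w_gt0 a; have := w_gt0 (val b); nia.
  have -> : (elim_weight (b, i) + w a)%N = elim_weight (b, Ordinal ic).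
    by rewrite /elim_weight /= mulSn addnCA addnC.
  exact: (LieGen elim_weight elim_gen (b, Ordinal ic)).
- have kx := gam' lx; have ky := gam' ly.
  apply: (cong' (x := [~ x, g a] * [~ y, g a])).
    by rewrite qgM -(@qgRMl _ _ k (w a)).
  by apply: LieM; [exact: IHx|exact: IHy].
- have kx := gam' lx.
  apply: (cong' (x := [~ x, g a]^-1)); last by apply: LieV; exact: IH.
  by rewrite qgV (@qgRVl _ _ k (w a)).
- have kx := gam' lx; have ky := gam' ly.
  have lxa : lie' (i + w a) [~ x, g a] by apply: IHx; lia.
  have lya : lie' (j + w a) [~ y, g a] by apply: IHy; lia.
  apply: (cong' (x := [~ [~ x, g a], y] * [~ x, [~ y, g a]])).
    rewrite qgM -(@qg_jacobi _ _ i j (w a)) //; [exact: gt0' lx|exact: gt0' ly].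
  apply: LieM; last by rewrite -addnA; exact: LieR.
  by rewrite addnAC; exact: LieR.
- apply: LieLow; first by rewrite addn_gt0 k0.
  by rewrite -addSn; exact: gamR.
Qed.

(** The elements [y] that can replace [g a] in [lie_ad] form a subgroup. *)
Lemma lie_ad_zpow k x e : lie' k x -> (k + w a <= c)%N ->
  lie' (k + w a) [~ x, zpow (g a) e].
Proof.
move=> lx kc.
suff [] : gam (w a) (zpow (g a) e) /\ lie' (k + w a) [~ x, zpow (g a) e] by [].
have k0 : (0 < k + w a)%N by rewrite addn_gt0 w_gt0 orbT.
have kx := gam' lx.
apply: (@zpow_subgroup _
  [set y | gam (w a) y /\ lie' (k + w a) [~ x, y]]).
  split=> /=.
  - by split; [exact: gam1|rewrite commg1; exact: lie1].
  - move=> y z [gy ly] [gz lz]; split; first exact: gamM.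
    apply: (cong' (x := [~ x, y] * [~ x, z])); last exact: LieM.
    by rewrite qgM -(@qgRMr _ _ k (w a)).
  - move=> y [gy ly]; split; first exact: gamV.
    apply: (cong' (x := [~ x, y]^-1)); last exact: LieV.
    by rewrite qgV (@qgRVr _ _ k (w a)).
by split=> //; exact: lie_ad.
Qed.

(** Lazard elimination. Since the new letters span a Lie ring stable under
    bracketing with [a], adding the multiples of [a] to it gives a Lie ring, and it
    contains all the old letters. *)
Lemma lie_elim k x : lie w g k x -> (k <= c)%N ->
  exists l e, [/\ lie' k l, k = w a \/ e = 0%R & x = l * zpow (g a) e].
Proof.
have gz k' e : k' = w a \/ e = 0%R -> gam k' (zpow (g a) e).
  by case=> ->; [apply: zpow_subgroup => //; exact: gam_subgroup|exact: gam1].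
elim=> {k x} [x|k x y _ IHx _ IHy|k x _ IH|i j x y lx IHx ly IHy|k x k0 xk] kc.
- have [->|xa] := eqVneq x a.
    exists 1, 1%R; rewrite mul1g zpow1; split=> //; last by left.
    exact: lie1.
  exists (g x), 0%R; rewrite zpow0 mulg1; split=> //; last by right.
  have := LieGen elim_weight elim_gen (Sub x xa, ord0).
  by rewrite /elim_weight /elim_gen /= addn0.
- have [l [e [ll ke ->]]] := IHx kc; have [l' [f [ll' kf ->]]] := IHy kc.
  exists (l * zpow (g a) e * (l' * zpow (g a) f) * (zpow (g a) (e + f))^-1), (e + f)%R.
  split; last by rewrite mulgVK.
    apply: (cong' (x := l * l')); last exact: LieM.
    rewrite zpowD !(qgM, qgV) invgM -!mulgA mulVKg.
    by rewrite (mulgA _ (qg _ l')) (qgC _ (gz _ _ ke)) -mulgA mulgV mulg1.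
  by case: ke; case: kf; [left|left|left|move=> -> ->; right].
- have [l [e [ll ke ->]]] := IH kc.
  exists ((l * zpow (g a) e)^-1 * (zpow (g a) (- e)%R)^-1), (- e)%R.
  split; last by rewrite mulgVK.
    apply: (cong' (x := l^-1)); last exact: LieV.
    rewrite zpowN invgK invgM !(qgM, qgV) -mulgA -qgV -(qgC _ (gz _ _ ke)).
    by rewrite mulKg.
  by case: ke => [->|->]; [left|right; rewrite oppr0].
- have ic : (i <= c)%N by lia.
  have jc : (j <= c)%N by lia.
  have [l [e [ll ke xE]]] := IHx ic; have [l' [f [ll' kf yE]]] := IHy jc.
  exists [~ x, y], 0%R; rewrite zpow0 mulg1; split=> //; last by right.
  set ae := zpow (g a) e in xE; set af := zpow (g a) f in yE.
  have i0 := gt0' ll; have j0 := gt0' ll'.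
  have il := gam' ll; have jl := gam' ll'.
  have iae : gam i ae := gz _ _ ke; have jaf : gam j af := gz _ _ kf.
  apply: (cong' (x := [~ l, l'] * [~ l, af] * ([~ ae, l'] * [~ ae, af]))).
    have yj : gam j y by rewrite yE; exact: gamM.
    rewrite xE (@qgRMl _ _ i j) // yE !(@qgRMr _ _ i j) //.
    by rewrite !qgM.
  apply: LieM; apply: LieM.
  - exact: LieR.
  - case: kf => [jE|f0]; last first.
      by rewrite /af f0 zpow0 commg1; apply: lie1; rewrite addn_gt0 i0.
    by rewrite jE; apply: lie_ad_zpow; rewrite -?jE.
  - case: ke => [iE|e0]; last first.
      by rewrite /ae e0 zpow0 comm1g; apply: lie1; rewrite addn_gt0 i0.
    rewrite -invgR addnC iE; apply: LieV.
    by apply: lie_ad_zpow; rewrite -?iE // addnC.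
  - by rewrite /ae /af zpowR; apply: lie1; rewrite addn_gt0 i0.
- by exists x, 0%R; rewrite zpow0 mulg1; split; [exact: LieLow|right|].
Qed.

End Elimination.
End GradedLie.

(** * Freeness of leading terms *)

Section Magnus.
Variable n : nat.
Local Notation F := (free_group n).

(** Only the linear coefficient of the images of the generators is prescribed,
    since leading terms depend on nothing else. *)
Definition magnus (V : lmodType rat) (t : 'I_n -> endo V) :
    F -> units (endo (nat -> V)) :=
  free_lift (fun j => sval (cid (ulead_surj (t j) (ltn0Sn 0)))).
HB.instance Definition _ V t := UMagmaMorphism.on (@magnus V t).

Lemma magnusM V t : {morph @magnus V t : x y / x * y}.
Proof. exact: gmulfM. Qed.

Lemma ulead_magnus_gen (V : lmodType rat) (t : 'I_n -> endo V) j :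
  ulead 1 (magnus t (free_gen j)) (t j).
Proof. by rewrite /magnus free_lift_gen; case: cid. Qed.

Lemma Ufilt_magnus (V : lmodType rat) (t : 'I_n -> endo V) k x :
  (0 < k)%N -> lower_central F k x -> Ufilt k (magnus t x).
Proof.
apply: (gam_morph (@magnusM V t) (K := @Ufilt V)).
- exact: Ufilt_subgroup.
- by move=> i u v ui v1; rewrite -[i.+2]addn1; exact: UfiltR.
- apply: free_gen_ind => [|j]; last exact: ulead_Ufilt (ulead_magnus_gen t j).
  have [s1 sM sV] := @Ufilt_subgroup V 1.
  split=> [|x' y|x'] /=; rewrite ?gmulf1 ?gmulfM ?gmulfV //; [exact: sM|exact: sV].
Qed.

(** The leading terms of the [g x] generate a free associative algebra: they
    can be made to act in any prescribed way, on a quotient of a representation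
    of the generators. *)
Definition lie_free (X : Type) (w : X -> nat) (g : X -> F) : Prop :=
  forall (V : lmodType rat) (s : X -> endo V),
  exists (V' : lmodType rat) (t : 'I_n -> endo V') (eps : V' -> V),
  [/\ forall y, exists x, eps x = y,
      {morph eps : x y / (x - y)%R} &
      forall x, exists2 l, ulead (w x) (magnus t (g x)) l &
                           forall v, eps (l v) = s x (eps v)].

Lemma lie_free_gen : lie_free (fun=> 1%N) (@free_gen n).
Proof.
move=> V s; exists V, s, id; split=> // [y|j]; first by exists y.
by exists (s j) => //; exact: ulead_magnus_gen.
Qed.

(** Sequences form the module coinduced from the subalgebra generated by the
    iterated brackets [b_i = [b, a, ..., a]], on which [b_i] acts on [V] by
    [S i]: the letter [a] acts by the left shift, and the recursion below reads
    [b_i * a - a * b_i = b_(i+1)]. Evaluating a sequence at [0] recovers the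
    original action of the [b_i]. *)
Section Coinduced.
Variable V : lmodType rat.
Implicit Type v : nat -> V.

Definition lshift_fun v : nat -> V := fun k => v k.+1.
Fact lshiftB v v' : lshift_fun (v - v')%R = (lshift_fun v - lshift_fun v')%R.
Proof. by []. Qed.
Definition lshift := @Endo (nat -> V) lshift_fun lshiftB.

Variable S : nat -> endo V.

Fixpoint coind_fun (k i : nat) v : V :=
  if k is k'.+1 then (coind_fun k' i (lshift v) - coind_fun k' i.+1 v)%R
  else S i (v 0%N).

Fact coindB i v v' : (fun k => coind_fun k i (v - v')%R) =
  ((fun k => coind_fun k i v) - (fun k => coind_fun k i v'))%R :> (nat -> V).
Proof.
apply/funext => k; elim: k i v v' => [|k IH] i v v' /=.
  by rewrite !seqD !seqN /= endoB.
rewrite lshiftB !IH !seqD !seqN /=.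
have e (p p' q q' : V) : ((p - p') - (q - q') = (p - q) - (p' - q'))%R.
  by rewrite !opprB addrACA [RHS]addrACA; congr (_ + _)%R; rewrite addrC.
exact: e.
Qed.
Definition coind i := @Endo (nat -> V) (fun v k => coind_fun k i v) (coindB i).

Lemma coind_bracket i v :
  (coind i (lshift v) - lshift (coind i v) = coind i.+1 v)%R.
Proof.
by apply/funext => k; rewrite seqD seqN /= /lshift_fun /= opprB addrC subrK.
Qed.
End Coinduced.

(** An action of the new letters on [V] is the quotient of an action of the old
    letters on sequences, which in turn lifts by freeness of the old letters. *)
Lemma lie_free_elim c (X : finType) (w : X -> nat) (g : X -> F) (a : X) :
  (forall x, 0 < w x)%N -> lie_free w g ->
  lie_free (@elim_weight c X w a) (@elim_gen _ c X g a).
Proof.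
move=> w0 free V s.
pose S (b : {x : X | x != a}) i : endo V :=
  if (i < c.+1)%N then s (b, inord i) else 0%R.
pose s1 x : endo (nat -> V) :=
  if insub x is Some b then coind (S b) 0 else lshift V.
have s1a : s1 a = lshift V by rewrite /s1 insubF ?eqxx.
have s1b (b : {x : X | x != a}) : s1 (val b) = coind (S b) 0 by rewrite /s1 valK.
have [V' [t [eps [eps_surj epsB lg]]]] := free _ s1.
exists V', t, (fun v => eps v 0%N); split=> [y|x y|[b i]].
- by have [v vE] := eps_surj (fun=> y); exists v; rewrite vE.
- by rewrite epsB.
have [la la_lead laE] := lg a; rewrite s1a in laE.
suff H j : exists2 l, ulead (w (val b) + j * w a)
      (magnus t (ad_iter g a j (g (val b)))) l &
    forall v, eps (l v) = coind (S b) j (eps v).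
  have [l l_lead lE] := H i; exists l => // v.
  (* at index [0] the coinduced action is [S b i], that is [s (b, i)] *)
  by rewrite lE /= /S ltn_ord inord_val.
elim: j => [|j [l l_lead lE]].
  by rewrite addn0; have [l] := lg (val b); rewrite s1b; exists l.
exists (l * la - la * l)%R.
  rewrite mulSn addnCA addnC /= gmulfR; apply: uleadR => //.
  by rewrite addn_gt0 w0.
by move=> v; rewrite endoE epsB lE !laE lE coind_bracket.
Qed.
End Magnus.

(** * The theorem of Magnus *)

Section MagnusKernel.
Variable n : nat.
Local Notation F := (free_group n).
Local Notation gam := (lower_central F).

Lemma ulead_zpow (V : zmodType) k (u : units (endo (nat -> V))) l e :
  (0 < k)%N -> ulead k u l -> ulead k (zpow u e) (l *~ e)%R.
Proof.
move=> k0 ul.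
have X m : ulead k (u ^+ m) (l *+ m)%R.
  elim: m => [|m IH]; first by rewrite expg0; exact: ulead1.
  by rewrite expgS mulrS; exact: uleadM.
by case: e => m; [exact: X|apply: uleadV => //; exact: X].
Qed.

(** The leading term of the removed letter is independent from the Lie algebra
    of the remaining ones: let it act as the identity of the rationals and the
    others as zero. *)
Lemma lie_elim_exponent c (X : finType) (w : X -> nat) (g : X -> F) (a : X) l e :
    (forall x, 0 < w x)%N -> (forall x, gam (w x) (g x)) -> lie_free w g ->
    lie (elim_weight (c := c) w (a := a)) (elim_gen g (a := a)) (w a) l ->
    (forall (V : lmodType rat) (t : 'I_n -> endo V),
       Ufilt (w a).+1 (magnus t (l * zpow (g a) e))) ->
  e = 0%R.
Proof.
move=> w0 gg free ll inv.
pose s x : endo rat^o := if x == a then 1%R else 0%R.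
have [V [t [eps [eps_surj epsB lg]]]] := free _ s.
have eps0 : eps 0%R = 0%R by rewrite -(subrr 0%R) epsB subrr.
have epsN x : eps (- x)%R = (- eps x)%R by rewrite -[(- x)%R]sub0r epsB eps0 sub0r.
have epsD x y : eps (x + y)%R = (eps x + eps y)%R.
  by rewrite -{1}[y]opprK epsB epsN opprK.
(* brackets of letters acting as zero act as zero, even those with [a] *)
have killed k x : lie (elim_weight (c := c) w (a := a)) (elim_gen g (a := a)) k x ->
    (0 < k)%N /\ exists2 l', ulead k (magnus t x) l' & forall v, eps (l' v) = 0%R.
  elim=> {k x} [[b i]|k x y _ [k0 [lx lxl lx0]] _ [_ [ly lyl ly0]]
    |k x _ [k0 [lx lxl lx0]]
    |i j x y _ [i0 [lx lxl lx0]] _ [j0 [ly lyl ly0]]|k x k0 xk].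
  - split; first exact: elim_weight_gt0.
    have [la la_lead laE] := lg a.
    rewrite /elim_weight /elim_gen /=; elim: (nat_of_ord i) => [|j [lb lbl lb0]].
      have [lb lbl lbE] := lg (val b); exists lb; first by rewrite addn0.
      by move=> v; rewrite lbE /s (negbTE (valP b)).
    exists (lb * la - la * lb)%R.
      rewrite mulSn addnCA addnC /= gmulfR; apply: uleadR => //.
      by rewrite addn_gt0 w0.
    by move=> v; rewrite epsB lb0 laE lb0 endo0 subr0.
  - split=> //; exists (lx + ly)%R; first by rewrite gmulfM; exact: uleadM.
    by move=> v; rewrite endoE_add epsD lx0 ly0 addr0.
  - split=> //; exists (- lx)%R; first by rewrite gmulfV; exact: uleadV.
    by move=> v; rewrite endoE_opp epsN lx0 oppr0.
  - split; first by rewrite addn_gt0 i0.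
    exists (lx * ly - ly * lx)%R; first by rewrite gmulfR; exact: uleadR.
    by move=> v; rewrite epsB lx0 ly0 subr0.
  - split=> //; exists 0%R; first by apply/ulead0P; exact: Ufilt_magnus.
    by move=> v; rewrite endoE_zero.
have [k0 [l' l'l l'0]] := killed _ _ ll.
have [la la_lead laE] := lg a.
have := uleadM k0 l'l (ulead_zpow e k0 la_lead).
have zpowE : magnus t (zpow (g a) e) = zpow (magnus t (g a)) e.
  by case: e {inv} => m /=; rewrite ?gmulfV gmulfXn.
rewrite -zpowE -gmulfM => /lead_uniq /(_ (iffRL (ulead0P _ _) (inv _ t))) eq0.
have [v v1] := eps_surj 1%R.
have : eps ((l' + la *~ e) v)%R = 0%R by rewrite eq0 endoE_zero.
have epsz m : eps ((la *~ m) v)%R = (m%:~R)%R.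
  have la1 : eps (la v) = 1%R by rewrite laE v1 /s eqxx endoE_one.
  have epsn p : eps ((la *+ p) v)%R = p%:R%R.
    elim: p => [|p IH]; first by rewrite mulr0n endoE_zero.
    by rewrite mulrS endoE_add epsD la1 IH -natr1 addrC.
  by case: m => p; rewrite ?NegzE ?mulrNz ?endoE_opp ?epsN -pmulrn epsn ?mulrNz -?pmulrn.
rewrite endoE_add epsD l'0 add0r epsz => /eqP; rewrite intr_eq0.
by move/eqP.
Qed.

(** The letters of least weight [d] are eliminated one by one; [s] bounds their
    number, and the letters created by an elimination have larger weight. When
    none is left [d] increases, and [m] bounds the distance to the weight [c].
    Once [d] exceeds [c], no letter has weight at most [c], so that the Lie ring
    vanishes in these weights. *)
Lemma lie_magnus_kernel c m s (X : finType) (w : X -> nat) (g : X -> F) d :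
    (c < d + m)%N -> (0 < d)%N -> (forall x, d <= w x)%N ->
    (#|[pred x | w x == d]| < s)%N ->
    (forall x, gam (w x) (g x)) -> lie_free w g ->
  forall k x, lie w g k x -> (k <= c)%N ->
    (forall (V : lmodType rat) (t : 'I_n -> endo V), Ufilt k.+1 (magnus t x)) ->
  gam k.+1 x.
Proof.
elim: m s X w g d => [|m IHm].
  move=> s X w g d; rewrite addn0 => cd d0 wd _ gg _ k x lx kc _.
  have w0 y : (0 < w y)%N by exact: leq_trans d0 (wd y).
  elim: lx kc => {k x} [x|k x y _ IHx _ IHy|k x _ IH|i j x y lx IHx ly IHy|//] kc.
  - by have := wd x; lia.
  - by apply: gamM; [exact: IHx|exact: IHy].
  - by apply: gamV; exact: IH.
  - have i0 := lie_gt0 w0 lx; have j0 := lie_gt0 w0 ly.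
    apply: (@gamR' _ _ i.+1 j.+1); first by lia.
      by apply: IHx; lia.
    by apply: IHy; lia.
elim=> [//|s IHs] X w g d cd d0 wd cnt gg free k x lx kc inv.
have w0 y : (0 < w y)%N by exact: leq_trans d0 (wd y).
have [a /eqP wa|no] := pickP [pred y | w y == d]; last first.
  apply: (IHm #|[pred x | w x == d.+1]|.+1 X w g d.+1) => //; first by rewrite addSnnS.
  by move=> y; rewrite ltn_neqAle wd andbT eq_sym; apply/negbT/no.
have [l [e [ll ke xE]]] := lie_elim a w0 gg lx kc.
have e0 : e = 0%R.
  case: ke => // ka; apply: (lie_elim_exponent (c := c) (a := a) (l := l) w0 gg free).
    by rewrite -ka.
  by rewrite -ka -xE.
rewrite e0 zpow0 mulg1 in xE; rewrite -xE in ll.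
apply: (IHs _ _ _ d cd d0 _ _ _ _ k x ll kc inv).
- by move=> y; apply: leq_trans (leq_addr _ _); exact: wd.
- rewrite -ltnS; apply: leq_trans cnt; rewrite ltnS.
  pose f (y : elim_type c a) := val y.1.
  rewrite -[X in (X < _)%N](card_in_image (f := f)).
    apply: (@leq_ltn_trans #|[predD1 [pred x | w x == d] & a]|); last first.
      by rewrite (cardD1 a [pred x | w x == d]) inE wa eqxx add1n.
    apply: subset_leq_card; apply/fintype.subsetP => _ /fintype.imageP[y yd ->].
    rewrite !inE (valP y.1) /= /f; move: yd (wd (val y.1)); rewrite inE /elim_weight.
    by move: (w (val y.1)) (y.2 * w a)%N => p q /=; lia.
  have lvl0 y : y \in [pred x | elim_weight (c := c) w (a := a) x == d] -> y.2 = ord0.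
    rewrite inE /elim_weight => yd; apply: val_inj => /=.
    move: yd (wd (val y.1)); rewrite wa; move: (w (val y.1)) (nat_of_ord y.2) => p q.
    by move: d0 {cd wa} => d0 /eqP pq dp; case: q pq => [//|q]; rewrite mulSn; lia.
  move=> [b i] [b' i'] yd yd' /val_inj /= bb'.
  by rewrite bb' (lvl0 _ yd : i = _) (lvl0 _ yd' : i' = _).
- exact: gam_elim_gen.
- exact: lie_free_elim.
Qed.

Lemma gam_lie k x : (0 < k)%N -> gam k x -> lie (fun=> 1%N) (@free_gen n) k x.
Proof.
case: k => [//|k] _; elim: k x => [|k IH] x xk.
  move: x {xk}; apply: free_gen_ind => [|j].
    by split=> [|x y|x]; [exact: lie1|exact: LieM|exact: LieV].
  exact: (LieGen (fun=> 1%N) (@free_gen n) j).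
move: x xk; apply: generated_ind.
  by split=> [|x y|x]; [exact: lie1|exact: LieM|exact: LieV].
move=> _ [[x y] [/= xk _] <-]; rewrite -[k.+2]addn1; apply: LieR; first exact: IH.
move: y; apply: free_gen_ind => [|j].
  by split=> [|u v|u]; [exact: lie1|exact: LieM|exact: LieV].
exact: (LieGen (fun=> 1%N) (@free_gen n) j).
Qed.

(** Membership climbs the lower central series: an element of [gam k] whose
    coefficients of degree [k] all vanish lies in [gam k.+1]. *)
Theorem magnus_kernel c x :
  (forall (V : lmodType rat) (t : 'I_n -> endo V), Ufilt c.+1 (magnus t x)) ->
  gam c.+1 x.
Proof.
move=> inv; suff H k : (k <= c)%N -> gam k.+1 x by exact: H.
elim: k => [//|k IH] kc; have xk := IH (ltnW kc).
apply: (@lie_magnus_kernel c c #|'I_n|.+1 _ (fun=> 1%N) (@free_gen n) 1) => //.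
- exact: lie_free_gen.
- exact: gam_lie.
- by move=> V t; apply: Ufilt_le (inv V t).
Qed.
End MagnusKernel.

(** * Solving relations over the rationals *)

Lemma endoE_mulrz (V : zmodType) (f : endo V) (e : int) x :
  (f *~ e)%R x = (f x *~ e)%R.
Proof.
have E p : (f *+ p)%R x = (f x *+ p)%R.
  by elim: p => [|p IH]; rewrite ?mulr0n // !mulrS endoE_add IH.
by case: e => p; rewrite ?NegzE ?mulrNz ?endoE_opp -!pmulrn E.
Qed.

Section Perturbation.
Variables (n : nat) (V : zmodType).
Local Notation U := (units (endo (nat -> V))).
Implicit Types (u : 'I_n -> U) (l : 'I_n -> endo V) (w : word n).

Definition exponent_sum w j : int := (\sum_(l <- w | l.1 == j) (-1) ^+ l.2)%R.

(** Conjugation by a unipotent unit multiplies by a commutator of higher order. *)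
Lemma uleadJ k (x y : U) (l : endo V) :
  (0 < k)%N -> ulead k x l -> Ufilt 1 y -> ulead k (x ^ y) l.
Proof.
move=> k0 xl y1; rewrite -[x ^ y](mulVKg x) -commgEl -[l]addr0.
apply: uleadM => //; apply/ulead0P; rewrite -addn1; apply: UfiltR => //.
exact: ulead_Ufilt xl.
Qed.

Lemma ulead_letter_eval u u' l k j b : (0 < k)%N ->
    (forall i, Ufilt 1 (u i)) -> (forall i, ulead k ((u i)^-1 * u' i) (l i)) ->
  ulead k ((letter_eval u (j, b))^-1 * letter_eval u' (j, b))
    (l j *~ (-1) ^+ b)%R.
Proof.
move=> k0 u1 ul; rewrite /letter_eval; case: b => /=; last exact: ul.
have -> : (u j)^-1^-1 * (u' j)^-1 = ((u j)^-1 * u' j)^-1 ^ (u j)^-1.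
  by rewrite conjgE invgM !invgK !mulgA mulgK.
have [_ _ V1] := @Ufilt_subgroup V 1.
rewrite expr1 mulrNz mulr1z; apply: uleadJ => //; last exact: V1.
exact: uleadV.
Qed.

(** First-order perturbation of a word: only exponent sums matter. *)
Lemma ulead_word_eval u u' l k w : (0 < k)%N ->
    (forall i, Ufilt 1 (u i)) -> (forall i, ulead k ((u i)^-1 * u' i) (l i)) ->
  ulead k ((word_eval u w)^-1 * word_eval u' w)
    (\sum_j l j *~ exponent_sum w j)%R.
Proof.
move=> k0 u1 ul; elim: w => [|[i b] w IH].
  rewrite /word_eval !big_nil invg1 mulg1 big1 ?ulead1 // => [|j _].
    exact: ulead1.
  by rewrite /exponent_sum big_nil.
have -> : (\sum_j l j *~ exponent_sum ((i, b) :: w) j =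
    l i *~ (-1) ^+ b + \sum_j l j *~ exponent_sum w j)%R.
  rewrite (bigD1 i) //= [in RHS](bigD1 i) //= addrA; congr (_ + _)%R.
    by rewrite /exponent_sum big_cons eqxx mulrzDr.
  apply: eq_bigr => j ji.
  by rewrite /exponent_sum big_cons eq_sym (negbTE ji).
rewrite !word_eval_cons.
set x := letter_eval u _; set x' := letter_eval u' _.
have -> : (x * word_eval u w)^-1 * (x' * word_eval u' w) =
    (x^-1 * x') ^ word_eval u w * ((word_eval u w)^-1 * word_eval u' w).
  by rewrite conjgE invgM !mulgA mulgK.
apply: uleadM => //; apply: uleadJ => //; first exact: ulead_letter_eval.
by apply: word_eval_subgroup => //; exact: Ufilt_subgroup.
Qed.
End Perturbation.

(** The degree-one case of the theorem of Magnus: the linear coefficient of the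
    image of a word only sees its exponent sums. *)
Lemma gam2_exponent_sum n (v w : word n) : exponent_sum v =1 exponent_sum w ->
  lower_central (free_group n) 2 ((free_of_word v)^-1 * free_of_word w).
Proof.
move=> vw; apply: magnus_kernel => V t.
pose u (j : 'I_n) : units (endo (nat -> V)) := 1.
have word_lead x : ulead 1 (magnus t (free_of_word x))
    (\sum_j t j *~ exponent_sum x j)%R.
  have u1 j : Ufilt 1 (u j) by have [] := @Ufilt_subgroup V 1.
  have ut j : ulead 1 ((u j)^-1 * magnus t (free_gen j)) (t j).
    by rewrite invg1 mul1g; exact: ulead_magnus_gen.
  have := ulead_word_eval x (ltn0Sn 0) u1 ut.
  have -> : word_eval u x = 1.
    by rewrite /word_eval big1 // => -[j []] _; rewrite /letter_eval /= ?invg1.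
  rewrite invg1 mul1g free_of_word_eval.
  by rewrite (morph_word_eval _ _ (@magnusM _ V t)).
apply/ulead0P; rewrite gmulfM gmulfV.
rewrite -(addNr (\sum_j t j *~ exponent_sum v j)%R).
apply: uleadM => //; first by apply: uleadV => //; exact: word_lead.
by under eq_bigr => j do rewrite vw; exact: word_lead.
Qed.

Section SolveRelations.
Variables (m n : nat) (r : 'I_m -> word n).
Local Notation M := (relation_matrix r).
Variables (A0 : {set 'I_n}) (N : int) (Z : 'M[int]_(n, m)).
Hypothesis N0 : N != 0%R.
Hypothesis MZ : (M *m Z = N%:M)%R.
Hypothesis Z0 : forall j i, j \in A0 -> Z j i = 0%R.

Fact scale_endoB (V : lmodType rat) (a : rat) (x y : V) :
  (a *: (x - y) = a *: x - a *: y)%R.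
Proof. exact: scalerBr. Qed.
Definition scale_endo (V : lmodType rat) a := Endo (@scale_endoB V a).

(** Newton's method: in a unipotent group over the rationals, the relators can
    be killed degree by degree by moving the letters outside [A0] only. *)
Lemma solve_relations (V : lmodType rat) (u0 : 'I_n -> units (endo (nat -> V))) k :
  (forall j, Ufilt 1 (u0 j)) ->
  exists u, [/\ forall j, Ufilt 1 (u j), forall j, j \in A0 -> u j = u0 j &
                forall i, Ufilt k.+1 (word_eval u (r i))].
Proof.
move=> u01; elim: k => [|k [u [u1 uA0 uk]]].
  exists u0; split=> // i; apply: word_eval_subgroup => //.
  exact: Ufilt_subgroup.
have /choice[d dP] i := lead_ex (uk i).
(* [l] solves the system [M l = - d], by [M *m Z = N%:M] *)
pose l j := (- (scale_endo V N%:~R^-1 * \sum_i d i *~ Z j i))%R.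
have vP j : exists v, ulead k.+1 v (l j) /\ (j \in A0 -> v = 1).
  have [jA|jA] := boolP (j \in A0); last by have [v] := ulead_surj (l j) (ltn0Sn k); exists v.
  exists 1; split=> //.
  have -> : l j = 0%R; last exact: ulead1.
  by rewrite /l big1 ?mulr0 ?oppr0 // => i _; rewrite Z0.
have /choice[v {}vP] := vP.
have [_ M1 V1] := @Ufilt_subgroup V 1.
exists (fun j => u j * v j); split=> [j|j jA|i].
- by apply: M1 => //; apply: Ufilt_le (ulead_Ufilt (vP j).1).
- by rewrite (vP j).2 // mulg1 uA0.
apply/ulead0P; set u' := fun j => _.
rewrite -[word_eval u' _](mulVKg (word_eval u (r i))).
have ul j : ulead k.+1 ((u j)^-1 * u' j) (l j) by rewrite mulKg; exact: (vP j).1.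
have -> : 0%R = (d i + \sum_j l j *~ exponent_sum (r i) j)%R.
  have -> : (\sum_j l j *~ exponent_sum (r i) j =
     - (scale_endo V N%:~R^-1 * \sum_i' d i' *~ (M *m Z) i i'))%R.
    rewrite mulr_sumr -sumrN.
    under eq_bigr => j _ do rewrite /l mulNrz mulr_sumr mulrz_suml -sumrN.
    rewrite exchange_big; apply: eq_bigr => i' _ /=.
    rewrite mxE mulrz_sumr mulr_sumr -sumrN; apply: eq_bigr => j _.
    by rewrite mxE mulrC mulrzA -mulrzAr.
  rewrite MZ (bigD1 i) //= big1 => [|i' i'i]; last first.
    by rewrite mxE eq_sym (negbTE i'i) mulr0z.
  rewrite addr0 mxE eqxx mulr1n; apply/esym/eqP; rewrite subr_eq0; apply/eqP.
  apply: endoP => x; rewrite endoE_mul /=.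
  have -> : ((d i *~ N) x = N%:~R *: d i x)%R.
    by rewrite scaler_int endoE_mulrz.
  by rewrite scalerA mulVf ?scale1r // intr_eq0.
apply: uleadM => //; first exact: dP.
exact: ulead_word_eval.
Qed.
End SolveRelations.

(** * Subgroups of finite index in nilpotent groups *)

Section FiniteIndex.
Variables (G : groupType) (H : set G).
Hypothesis sH : is_subgroup H.
Local Notation gam := (lower_central G).

Lemma qgX k x p : qg k (x ^+ p) = qg k (x : G) ^+ p. Proof. exact: gmulfXn. Qed.

Lemma qgRXl n i j x y p : n = (i + j)%N -> gam i x -> gam j y ->
  qg n.+1 [~ x ^+ p, y] = qg n.+1 [~ x, y] ^+ p.
Proof.
move=> nE xi yj; elim: p => [|p IH]; first by rewrite !expg0 comm1g qg1.
by rewrite !expgS (@qgRMl _ _ i j) // IH.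
Qed.

Lemma qgRXr n i j x y p : n = (i + j)%N -> gam i x -> gam j y ->
  qg n.+1 [~ x, y ^+ p] = qg n.+1 [~ x, y] ^+ p.
Proof.
move=> nE xi yj; elim: p => [|p IH]; first by rewrite !expg0 commg1 qg1.
by rewrite !expgS (@qgRMr _ _ i j) // IH.
Qed.

(** The trace of [H] on the quotient of [gam k] by [gam k.+1], as a set of
    representatives. *)
Definition layer k : set G :=
  [set x | exists h, [/\ H h, gam k h & gam k.+1 (h^-1 * x)]].

Lemma layer_subgroup k : is_subgroup (layer k).
Proof.
have [H1 HM HV] := sH; split.
- by exists 1; split=> //; rewrite ?invg1 ?mulg1; exact: gam1.
- move=> x y [h [Hh kh xh]] [h' [Hh' kh' yh']]; exists (h * h').
  split; [exact: HM|exact: gamM|].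
  have -> : (h * h')^-1 * (x * y) = (h^-1 * x) ^ h' * (h'^-1 * y).
    by rewrite conjgE invgM !mulgA mulgK.
  by apply: gamM => //; exact: gamJ.
- move=> x [h [Hh kh xh]]; exists h^-1; split; [exact: HV|exact: gamV|].
  have -> : h^-1^-1 * x^-1 = ((h^-1 * x) ^ h^-1)^-1.
    by rewrite conjgE invgK -mulgA mulVKg invgM invgK.
  by apply: gamV; exact: gamJ.
Qed.

Lemma gam_layer k x : gam k.+1 x -> layer k x.
Proof.
by case: sH => H1 _ _ xk; exists 1; rewrite invg1 mul1g; split=> //; exact: gam1.
Qed.

Lemma subgroup_cong k (D : set G) x y : is_subgroup D ->
  (forall z, gam k z -> D z) -> qg k x = qg k y -> D x -> D y.
Proof.
move=> [_ DM _] kD /qgP xy Dx; rewrite -[y](mulVKg x); apply: DM => //.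
exact: kD.
Qed.

Section Layers.
Variables (n : nat) (a : 'I_n -> G) (N : nat).
Hypothesis N0 : (0 < N)%N.
Hypothesis gen_a : forall D, is_subgroup D -> (forall j, D (a j)) -> forall x, D x.
Hypothesis aN : forall j, layer 1 (a j ^+ N).

(** Each layer is generated by finitely many elements having a power in [H],
    since iterated commutators of the [a j] inherit this property. *)
Lemma layer_generators k : exists (I : finType) (b : I -> G) (M : nat),
  [/\ (0 < M)%N, forall i, gam k.+1 (b i), forall i, layer k.+1 (b i ^+ M) &
      forall D, is_subgroup D -> (forall i, D (b i)) ->
        (forall x, gam k.+2 x -> D x) -> forall x, gam k.+1 x -> D x].
Proof.
elim: k => [|k [I [b [M [M0 kb bM bD]]]]].
  exists ('I_n : finType), a, N; split=> // D sD Da _ x _; exact: gen_a.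
exists (I * 'I_n)%type, (fun i => [~ b i.1, a i.2]), (M * N)%N; split.
- by rewrite muln_gt0 M0.
- by move=> [i j]; exact: gamRS.
- move=> [i j] /=; have [_ HM HV] := sH.
  have [h [Hh kh bh]] := bM i; have [h' [Hh' _ ah']] := aN j.
  exists [~ h, h']; split; last 1 first.
  + apply/qgP; rewrite expgnA.
    have e : k.+2 = (k.+1 + 1)%N by rewrite addn1.
    have -> : qg k.+3 ([~ b i, a j] ^+ M ^+ N) = qg k.+3 [~ b i ^+ M, a j ^+ N].
      rewrite !qgX -(@qgRXl _ k.+1 1) // -(@qgRXr _ k.+1 1) //; exact: gamX.
    rewrite -[b i ^+ M](mulVKg h) -[a j ^+ N](mulVKg h').
    rewrite (@qgRMl _ _ k.+1 1) // (@qgRMr _ _ k.+1 1) //.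
    rewrite (iffRL (qg1P _ [~ h, _ * _])) ?mulg1; last first.
      by rewrite -[k.+3]addn2; exact: gamR.
    rewrite (iffRL (qg1P _ [~ _ * _, _])) ?mulg1 //.
    by rewrite -[k.+3]addn1; exact: gamR.
  + by rewrite commgEl conjgE; apply: (HM _ _ (HV _ Hh)); apply: (HM _ _ (HV _ Hh')); exact: HM.
  + exact: gamRS.
move=> D sD Db Dk x.
have Dcong := subgroup_cong sD Dk.
have [D1 DM DV] := sD.
apply: generated_ind => // _ [[y z] [/= yk _] <-].
suff [] : gam k.+1 y /\ forall z, D [~ y, z] by [].
have e : k.+2 = (k.+1 + 1)%N by rewrite addn1.
apply: (bD [set y | gam k.+1 y /\ forall z, D [~ y, z]]) => //.
- split=> [|u v [uk Du] [vk Dv]|u [uk Du]] /=.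
  + by split=> [|t]; [exact: (@gam1 _ k.+1)|rewrite comm1g].
  + split=> [|t]; first exact: (@gamM _ k.+1).
    apply: (Dcong ([~ u, t] * [~ v, t])); last exact: DM.
    by rewrite qgM -(@qgRMl _ _ k.+1 1).
  + split=> [|t]; first exact: (@gamV _ k.+1).
    apply: (Dcong [~ u, t]^-1); last exact: DV.
    by rewrite qgV (@qgRVl _ _ k.+1 1).
- move=> i; split=> //; apply: (gen_a (D := [set z | D [~ b i, z]])) => [|j]; last exact: (Db (i, j)).
  split=> [|u v Du Dv|u Du] /=; first by rewrite commg1.
  + apply: (Dcong ([~ b i, u] * [~ b i, v])); last exact: DM.
    by rewrite qgM -(@qgRMr _ _ k.+1 1).
  + apply: (Dcong [~ b i, u]^-1); last exact: DV.
    by rewrite qgV (@qgRVr _ _ k.+1 1).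
- by move=> u uk; split=> [|t]; [exact: gamS|apply: Dk; exact: gamRS].
Qed.

(** A layer is abelian and generated by finitely many elements [b i] whose [M]-th
    powers lie in the trace of [H], so bounded exponents give representatives. *)
Lemma layer_finite_index k : exists B : seq G,
  (forall b, b \in B -> gam k.+1 b) /\
  forall x, gam k.+1 x -> exists2 b, b \in B & layer k.+1 (b^-1 * x).
Proof.
have [I [b [M [M0 kb bM bD]]]] := layer_generators k.
suff [S [B [[sS SM] kB SB]]] : exists (S : set G) (B : seq G),
    [/\ is_subgroup S /\ ((forall i, i \in enum I -> S (b i)) /\
          forall x, layer k.+1 x -> S x),
        forall b, b \in B -> gam k.+1 b &
        forall x, S x -> exists2 b, b \in B & layer k.+1 (b^-1 * x)].
  exists B; split=> // x xk; apply: SB; apply: bD xk => // [i|y yk].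
    by apply: SM.1; rewrite mem_enum.
  by apply: SM.2; exact: gam_layer.
(* [S] is the trace of [H] enlarged by the [b i] with [i] in the list *)
elim: (enum I) => [|i s [S [B [[sS [Sb SL]] kB SB]]]].
  exists (layer k.+1), [:: 1]; split; first by split=> //; exact: layer_subgroup.
    by move=> c; rewrite inE => /eqP->; exact: gam1.
  by move=> x xL; exists 1; rewrite ?inE // invg1 mul1g.
have [S1 SM SV] := sS.
have Scong := subgroup_cong sS (fun z zk => SL z (gam_layer zk)).
have kbX p : gam k.+1 (b i ^+ p) by exact: gamX.
have LX p : layer k.+1 (b i ^+ (M * p)).
  by rewrite expgnA; apply: subgroupX => //; exact: layer_subgroup.
have C p x := @qgC _ k.+1 (b i ^+ p) x (kbX p).
have CV p x := @qgC _ k.+1 (b i ^+ p)^-1 x (gamV (kbX p)).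
exists [set x | exists p, S ((b i ^+ p)^-1 * x)],
  [seq b i ^+ e * t | e <- iota 0 M, t <- B]; split.
- split; last split.
  + split=> [|x y [p Sx] [q Sy]|x [p Sx]] /=.
    * by exists 0%N; rewrite expg0 invg1 mulg1.
    * exists (p + q)%N.
      apply: (Scong ((b i ^+ p)^-1 * x * ((b i ^+ q)^-1 * y))); last exact: SM.
      by rewrite mulgA 2!qgM -CV -!qgM expgnDr invgM !mulgA.
    * exists (p * M.-1)%N.
      apply: (Scong (((b i ^+ p)^-1 * x)^-1 * (b i ^+ (M * p))^-1)).
        rewrite [RHS]qgM CV -qgM -[in (M * p)%N](prednK M0) mulSn mulnC addnC.
        by rewrite expgnDr !invgM invgK -mulgA mulVKg.
      by apply: SM; apply: SV => //; exact/SL/LX.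
  + move=> j; rewrite inE => /orP[/eqP->|js].
      by exists 1%N; rewrite expg1 mulVg.
    by exists 0%N; rewrite expg0 invg1 mul1g; exact: Sb.
  + by move=> x xL; exists 0%N; rewrite expg0 invg1 mul1g; exact: SL.
- move=> _ /allpairsP[[e t] [/= _ tB ->]]; apply: (@gamM _ k.+1); [exact: kbX|exact: kB].
- move=> x [p Sx]; have [t tB tL] := SB _ Sx.
  exists (b i ^+ (p %% M) * t).
    by apply: allpairs_f => //; rewrite mem_iota add0n ltn_mod.
  have Lcong := subgroup_cong (layer_subgroup k.+1) (@gam_layer k.+1).
  have [_ LM _] := layer_subgroup k.+1.
  apply: (Lcong (t^-1 * ((b i ^+ p)^-1 * x) * b i ^+ (M * (p %/ M)))); last exact: LM.
  rewrite -mulgA qgM [qg _ (_ * b i ^+ _)]qgM -C -!qgM.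
  rewrite [in (b i ^+ p)^-1](divn_eq p M) mulnC addnC expgnDr !invgM -!mulgA.
  by rewrite mulVKg.
Qed.

(** Decompositions [x = t * h * u] are improved layer by layer: [u] in [gam c.+1]
    is replaced by [b * h' * u'] with [u'] in [gam c.+2], and moving [b] across
    [h] only costs a commutator of the same depth as [u']. *)
Theorem nilpotent_transversal c : (forall x, gam c.+1 x -> x = 1) ->
  exists T : seq G, forall x, exists2 t, t \in T & exists2 h, H h & x = t * h.
Proof.
move=> nil; have [H1 HM HV] := sH.
suff [T TP] : exists T : seq G, forall x, exists2 t, t \in T &
    exists2 h, H h & gam c.+1 (h^-1 * (t^-1 * x)).
  exists T => x; have [t tT [h Hh /nil xE]] := TP x; exists t => //; exists h => //.
  by move/mulg1_eq: xE; rewrite invgK => ->; rewrite mulVKg.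
elim: c {nil} => [|c [T TP]].
  exists [:: 1] => x; exists 1; first by rewrite inE.
  by exists 1.
have [B [kB BL]] := layer_finite_index c.
exists [seq t * b | t <- T, b <- B] => x.
have [t tT [h Hh tk]] := TP x; have [b bB [h' [Hh' kh' bk]]] := BL _ tk.
exists (t * b); first exact: allpairs_f.
exists (h * h'); first exact: HM.
have -> : (h * h')^-1 * ((t * b)^-1 * x) =
   h'^-1 * (b^-1 * (h^-1 * (t^-1 * x))) * [~ b^-1, h] ^ (h^-1 * (t^-1 * x)).
  by rewrite commgEl !conjgE !invgM !invgK !mulgA !(mulgK, mulgVK).
by apply: gamM => //; apply/gamJ/gamRS/gamV/kB.
Qed.
End Layers.

Lemma transversal_finite_index (T : seq G) :
  (forall x, exists2 t, t \in T & exists2 h, H h & x = t * h) -> finite_index H.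
Proof.
move=> TP; have [_ HM HV] := sH.
apply: (@sub_finite_set _ _ ((fun t : G => [set t * h | h in H]) @` [set` T])); last first.
  by apply: finite_image; exact: finite_seq.
move=> _ [x _ <-]; have [t tT [h Hh xE]] := TP x; exists t => //.
apply/seteqP; split=> _ [y Hy <-].
  by exists (h^-1 * y); [apply: HM => //; exact: HV|rewrite xE mulgA mulgK].
by exists (h * y); [exact: HM|rewrite xE mulgA].
Qed.

End FiniteIndex.

(** * Presented nilpotent groups *)

Lemma to_quotient_surj (G : groupType) (N : normal_subgroup G) y :
  exists x, to_quotient N x = y.
Proof. by exists (repr y); rewrite /to_quotient reprK. Qed.

Section QuotientLift.
Variables (G H : groupType) (N : normal_subgroup G) (f : G -> H).
Hypotheses (fM : {morph f : x y / x * y}).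
Hypothesis fN : forall x, normal_carrier N x -> f x = 1.

Definition quotient_lift (y : quotient_group N) : H := f (repr y).

Lemma quotient_liftE x : quotient_lift (to_quotient N x) = f x.
Proof.
have /to_quotientP/fN : to_quotient N x = to_quotient N (repr (to_quotient N x)).
  by rewrite /to_quotient reprK.
have fV z : f z^-1 = (f z)^-1.
  by apply/esym/mulg1_eq; rewrite -fM mulgV; exact: multiplicative1.
by rewrite fM fV => /mulg1_eq; rewrite invgK.
Qed.

Lemma quotient_liftM : {morph quotient_lift : x y / x * y}.
Proof.
move=> x y; have [u <-] := to_quotient_surj x; have [v <-] := to_quotient_surj y.
by rewrite -to_quotientM !quotient_liftE fM.
Qed.
HB.instance Definition _ :=
  isMultiplicative.Build (quotient_group N) H quotient_lift quotient_liftM.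
Definition quotient_hom : {multiplicative quotient_group N -> H} := quotient_lift.
End QuotientLift.

Section Words.
Variable n : nat.

Lemma word_eval_inv (G : groupType) (u : 'I_n -> G) w :
  word_eval u (word_inv w) = (word_eval u w)^-1.
Proof.
elim: w => [|[i b] w IH]; first by rewrite /word_eval !big_nil invg1.
rewrite /word_inv /= rev_cons -cats1 word_eval_cat IH !word_eval_cons invgM.
congr (_ * _); rewrite /word_eval big_nil mulg1 /letter_eval /=.
by case: b; rewrite //= invgK.
Qed.

Lemma exponent_sum_cat (v w : word n) j :
  exponent_sum (v ++ w) j = (exponent_sum v j + exponent_sum w j)%R.
Proof. exact: big_cat. Qed.

Lemma exponent_sum_inv (w : word n) j :
  exponent_sum (word_inv w) j = (- exponent_sum w j)%R.
Proof.
elim: w => [|[i b] w IH]; first by rewrite /exponent_sum !big_nil oppr0.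
rewrite /word_inv /= rev_cons -cats1 exponent_sum_cat IH.
rewrite /exponent_sum !big_cons big_nil /=.
by case: ifP => _; case: b; rewrite ?addr0 // opprD ?opprK addrC.
Qed.
End Words.

Section Presentation.
Variables (c m n : nat) (r : 'I_m -> word n).
Local Notation F := (free_group n).
Local Notation G := (presented_group c r).
Local Notation M := (relation_matrix r).

Definition pres (x : F) : G := to_quotient _ (to_quotient _ x : free_nilpotent c n).

Lemma presM : {morph pres : x y / x * y}.
Proof. by move=> x y; rewrite /pres !to_quotientM. Qed.
HB.instance Definition _ :=
  isUMagmaMorphism.Build F G pres (multiplicative1 presM, presM).

Lemma pres_surj y : exists x, pres x = y.
Proof.
have [z <-] := to_quotient_surj y; have [x <-] := to_quotient_surj z.
by exists x.
Qed.

Lemma pres_gam k x : lower_central F k x -> lower_central G k (pres x).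
Proof.
case: k => [//|k]; apply: (gam_morph presM (K := lower_central G)) => //.
- exact: gam_subgroup.
- by move=> i u v ui _; exact: gamRS.
Qed.

Lemma pres_gam_surj k y : lower_central G k y ->
  exists2 x, lower_central F k x & pres x = y.
Proof.
have triv (y' : G) : exists2 x, True & pres x = y'.
  by have [x <-] := pres_surj y'; exists x.
elim: k y => [|[|k] IH] y; [by move=> _; exact: triv|by move=> _; exact: triv|].
apply: (@generated_ind _ _ [set y | exists2 x, lower_central F k.+2 x & pres x = y]).
  split=> [|_ _ [u uk <-] [v vk <-]|_ [u uk <-]] /=.
  - by exists 1; [exact: (@gam1 _ k.+2)|exact: gmulf1].
  - by exists (u * v); [exact: (@gamM _ k.+2)|exact: gmulfM].
  - by exists u^-1; [exact: (@gamV _ k.+2)|exact: gmulfV].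
move=> _ [[y1 y2] [/= /IH[x1 x1k <-] _] <-]; have [x2 <-] := pres_surj y2.
by exists [~ x1, x2]; [exact: (@gamRS _ k.+1)|exact: gmulfR].
Qed.

Lemma pres_nilpotent y : lower_central G c.+1 y -> y = 1.
Proof.
move=> /pres_gam_surj[x xc <-]; rewrite /pres.
rewrite (iffRL (to_quotient1P _ x)) ?gmulf1 //.
Qed.

Lemma pres_relator i : pres (free_of_word (r i)) = 1.
Proof. by apply/to_quotient1P => K [_]; apply; exists i. Qed.

(** To be used with [K] the set of elements that a given representation does not
    distinguish from [1]. *)
Lemma pres_kernel (K : set F) : is_normal K ->
    (forall x, lower_central F c.+1 x -> K x) ->
    (forall i, K (free_of_word (r i))) ->
  forall x, pres x = 1 -> K x.
Proof.
move=> [[K1 KM KV] KJ] cK rK x /to_quotient1P /=.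
move=> /(_ [set z | exists2 y, K y & to_quotient _ y = z]) [].
  split.
    split; first split=> [|_ _ [y Ky <-] [z Kz <-]|_ [y Ky <-]].
    - by exists 1; [|exact: gmulf1].
    - by exists (y * z); [exact: KM|exact: gmulfM].
    - by exists y^-1; [exact: KV|exact: gmulfV].
    move=> _ z [y Ky <-]; have [z' <-] := to_quotient_surj z.
    by exists (y ^ z'); [exact: KJ|exact: gmulfJ].
  by move=> _ [i _ <-]; exists (free_of_word (r i)).
move=> y Ky /to_quotientP /= /cK yx.
by rewrite -[x](mulVKg y); exact: KM.
Qed.

Section Subgroup.
Variable A0 : {set 'I_n}.
Local Notation H := (letters_subgroup c r A0).

Lemma letters_is_subgroup : is_subgroup H.
Proof. exact: generated_subgroup. Qed.

Lemma letters_mem j : j \in A0 -> H (pres (free_gen j)).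
Proof. by move=> jA; apply: generated_mem; exists j. Qed.

Definition sub_letters : free_group #|A0| -> F :=
  free_lift (fun q : 'I_#|A0| => free_gen (enum_val q)).
HB.instance Definition _ := UMagmaMorphism.on sub_letters.

(** A unipotent power-series representation of the free group on [A0] extends,
    modulo [z ^ c.+1], to the presented group; so it cannot detect an element that
    dies there. *)
Lemma letters_free N Z : N != 0%R -> (M *m Z = N%:M)%R ->
    (forall j i, j \in A0 -> Z j i = 0%R) ->
  forall x, pres (sub_letters x) = 1 -> lower_central _ c.+1 x.
Proof.
move=> N0 MZ Z0 x x1; apply: magnus_kernel => V t.
pose u0 (j : 'I_n) : units (endo (nat -> V)) :=
  if pselect (j \in A0) is left jA then magnus t (free_gen (enum_rank_in jA j))
  else 1.
have [_ M1 V1] := @Ufilt_subgroup V 1.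
have u01 j : Ufilt 1 (u0 j).
  rewrite /u0; case: pselect => [jA|_]; last by case: (@Ufilt_subgroup V 1).
  exact: ulead_Ufilt (ulead_magnus_gen t _).
have [u [u1 uA ur]] := solve_relations N0 MZ Z0 c u01.
have Uf z : Ufilt 1 (free_lift u z).
  elim/free_wordW: z => w; rewrite free_liftE.
  by apply: word_eval_subgroup => //; exact: Ufilt_subgroup.
have ext : free_lift u \o sub_letters =1 magnus t.
  apply: free_morph_ext.
  - by move=> y z; rewrite /= !gmulfM.
  - exact: magnusM.
  - move=> q; rewrite /= /sub_letters !free_lift_gen uA ?enum_valP //.
    rewrite /u0; case: pselect => [qA|]; last by rewrite enum_valP.
    by rewrite enum_valK_in.
rewrite -ext /=; apply: (pres_kernel (K := [set y | Ufilt c.+1 (free_lift u y)])) x1.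
- have [K1 KM KV] := @Ufilt_subgroup V c.+1.
  split; first split=> [|y z|y] /=; rewrite ?gmulf1 ?gmulfM ?gmulfV //.
  + exact: KM.
  + exact: KV.
  move=> y z /= yK; rewrite gmulfJ -[_ ^ _](mulVKg (free_lift u y)).
  apply: KM => //; rewrite -commgEl; apply: Ufilt_le (leqnSn _) _.
  by rewrite -addn1; apply: UfiltR => //; exact: Uf.
- move=> y; apply: (gam_morph (f := free_lift u) (K := @Ufilt V)) => //.
  + exact: gmulfM.
  + exact: Ufilt_subgroup.
  + by move=> k v w vk w1; rewrite -[k.+2]addn1; exact: UfiltR.
- by move=> i /=; rewrite free_liftE.
Qed.

Lemma letters_range : range (pres \o sub_letters) = H.
Proof.
apply/seteqP; split=> [_ [x _ <-]|] /=.
  have [H1 HM HV] := letters_is_subgroup.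
  move: x; apply: (free_gen_ind (H := [set x | H (pres (sub_letters x))])) => [|q].
    by split=> [|x y Hx Hy|x Hx] /=; rewrite ?gmulf1 ?gmulfM ?gmulfV;
      [|exact: HM|exact: HV].
  by rewrite /= /sub_letters free_lift_gen; apply: letters_mem; exact: enum_valP.
apply: generated_ind.
  split=> [|_ _ [x _ <-] [y _ <-]|_ [x _ <-]].
  - by exists 1 => //=; rewrite !gmulf1.
  - by exists (x * y) => //=; rewrite !gmulfM.
  - by exists x^-1 => //=; rewrite !gmulfV.
move=> _ [j jA ->]; exists (free_gen (enum_rank_in jA j)) => //=.
by rewrite /sub_letters free_lift_gen enum_rankK_in.
Qed.

Lemma letters_free_nilpotent N Z : N != 0%R -> (M *m Z = N%:M)%R ->
    (forall j i, j \in A0 -> Z j i = 0%R) ->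
  is_free_nilpotent c #|A0| H.
Proof.
move=> N0 MZ Z0.
have fM : {morph pres \o sub_letters : x y / x * y}.
  by move=> x y; rewrite /= !gmulfM.
have fN x : lower_central (free_group #|A0|) c.+1 x -> (pres \o sub_letters) x = 1.
  move=> xc; apply: pres_nilpotent; apply: pres_gam; move: xc.
  apply: (gam_morph (f := sub_letters) (K := lower_central F)) => //.
  - exact: gmulfM.
  - exact: gam_subgroup.
  - by move=> i u v ui _; exact: gamRS.
pose N' := NormalSubgroup (lower_central_normal (free_group #|A0|) c.+1).
pose f := quotient_hom (N := N') fM fN.
have fE v : f (to_quotient N' v) = pres (sub_letters v) := @quotient_liftE _ _ N' _ fM fN v.
exists f; split.
  move=> y z; have [v <-] := to_quotient_surj y; have [w <-] := to_quotient_surj z.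
  rewrite !fE => vw; apply/to_quotientP; apply: (letters_free N0 MZ Z0).
  by rewrite 2!gmulfM 2!gmulfV; move: vw => /= ->; rewrite mulVg.
rewrite -letters_range; apply/seteqP; split=> [_ [y _ <-]|_ [x _ <-]].
  have [v <-] := to_quotient_surj y.
  by exists v => //; rewrite fE.
by exists (to_quotient N' x) => //; rewrite fE.
Qed.
End Subgroup.
End Presentation.

(** * Relation matrices and the subgroup of letters *)

Section Roots.
Variables (c m n : nat) (r : 'I_m -> word n) (A0 : {set 'I_n}).
Local Notation F := (free_group n).
Local Notation G := (presented_group c r).
Local Notation M := (relation_matrix r).
Local Notation H := (letters_subgroup c r A0).
Local Notation pres := (@pres c m n r).

(** Exponent vectors are used instead of words because those that are realized form
    a subgroup, in which linear algebra over the integers can take place. *)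
Definition realized (v : 'rV[int]_n) : Prop :=
  exists2 w : word n, forall k, exponent_sum w k = v ord0 k &
                      layer H 1 (pres (free_of_word w)).

Lemma realizedD u v : realized u -> realized v -> realized (u + v)%R.
Proof.
move=> [w wu Hw] [w' wv Hw']; exists (w ++ w') => [k|].
  by rewrite exponent_sum_cat wu wv mxE.
rewrite free_of_wordM gmulfM; have [_ LM _] := layer_subgroup (letters_is_subgroup c r A0) 1.
exact: LM.
Qed.

Lemma realizedN u : realized u -> realized (- u)%R.
Proof.
move=> [w wu Hw]; exists (word_inv w) => [k|].
  by rewrite exponent_sum_inv wu mxE.
have [_ _ LV] := layer_subgroup (letters_is_subgroup c r A0) 1.
by rewrite free_of_word_eval word_eval_inv -free_of_word_eval gmulfV; exact: LV.
Qed.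

Lemma realized0 : realized 0%R.
Proof.
exists [::] => [k|]; first by rewrite /exponent_sum big_nil mxE.
have [L1 _ _] := layer_subgroup (letters_is_subgroup c r A0) 1.
by rewrite free_of_word_eval /word_eval big_nil gmulf1.
Qed.

Lemma realizedZ (z : int) u : realized u -> realized (z *: u)%R.
Proof.
move=> Ku; have Kn p : realized (u *+ p)%R.
  by elim: p => [|p IH]; [exact: realized0|rewrite mulrS; exact: realizedD].
rewrite -[z]intz scaler_int; case: z => p; first exact: Kn.
by rewrite NegzE mulrNz; apply: realizedN; exact: Kn.
Qed.

Lemma realized_sum I s (P : pred I) (f : I -> 'rV[int]_n) :
  (forall i, P i -> realized (f i)) -> realized (\sum_(i <- s | P i) f i)%R.
Proof. by apply: big_ind; [exact: realized0|exact: realizedD]. Qed.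

Lemma realized_row i : realized (row i M).
Proof.
exists (r i) => [k|]; first by rewrite !mxE.
rewrite pres_relator; by have [] := layer_subgroup (letters_is_subgroup c r A0) 1.
Qed.

Lemma layer_mem x : H x -> layer H 1 x.
Proof. by move=> Hx; exists x; split=> //; rewrite mulVg; exact: gam1. Qed.

Lemma exponent_sum_nseq N (j k : 'I_n) :
  exponent_sum (nseq N (j, false)) k = ((j == k)%:R *+ N)%R.
Proof.
elim: N => [|N IH]; first by rewrite /exponent_sum big_nil mulr0n.
rewrite -[nseq _ _]/([:: (j, false)] ++ nseq N (j, false)) exponent_sum_cat IH mulrS.
congr (_ + _)%R; rewrite /exponent_sum big_cons big_nil /=.
by case: ifP => _; rewrite ?addr0.
Qed.

Lemma realized_letter j : j \in A0 -> realized (delta_mx 0 j)%R.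
Proof.
move=> jA; exists [:: (j, false)] => [k|].
  by rewrite (exponent_sum_nseq 1) mulr1n mxE (eq_sym k).
by apply: layer_mem; apply: letters_mem.
Qed.

(** Row reduction modulo the letters of [A0]: some multiple of every letter is a
    combination of relators and letters of [A0] in the abelianization. *)
Lemma layer_letter_power N (Z : 'M[int]_(#|~: A0|, m)) :
    (Z *m remove_cols M A0 = (N%:Z)%:M)%R ->
  forall j, layer H 1 (presented_gen c r j ^+ N).
Proof.
move=> ZM j; have sL := layer_subgroup (letters_is_subgroup c r A0) 1.
have [jA|jA] := boolP (j \in A0).
  by apply: subgroupX => //; apply: layer_mem; exact: letters_mem.
have jA' : j \in ~: A0 by rewrite inE.
pose b := enum_rank_in jA' j.
have bE : enum_val b = j by rewrite enum_rankK_in.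
pose y := (row b Z *m M)%R.
have yM k : y ord0 k = (\sum_i Z b i * M i k)%R.
  by rewrite mxE; apply: eq_bigr => i _; rewrite mxE.
have yC k : k \notin A0 -> y ord0 k = ((j == k)%:R *+ N)%R.
  move=> kA; have kA' : k \in ~: A0 by rewrite inE.
  have := congr1 (fun X : 'M[int]_#|~: A0| => X b (enum_rank_in kA' k)) ZM.
  rewrite yM !mxE => E; rewrite -[RHS]mulr_natl natz.
  have -> : (j == k) = (b == enum_rank_in kA' k).
    rewrite -(inj_eq (@enum_val_inj _ (mem (~: A0)))) bE enum_rankK_in //.
  rewrite mulr_natr -E; apply: eq_bigr => i _.
  by rewrite [remove_cols _ _ _ _]mxE enum_rankK_in.
have [w wE wL] : realized (y - \sum_(k in A0) y ord0 k *: delta_mx 0 k)%R.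
  apply: realizedD.
    rewrite /y mulmx_sum_row; apply: realized_sum => i _.
    by apply: realizedZ; exact: realized_row.
  apply: realizedN; apply: realized_sum => k kA.
  by apply: realizedZ; exact: realized_letter.
have -> : presented_gen c r j ^+ N = pres (free_of_word (nseq N (j, false))).
  elim: N {ZM yC} => [|N IH]; first by rewrite expg0 free_of_word_eval /word_eval big_nil gmulf1.
  by rewrite expgS IH -[nseq N.+1 _]/([:: (j, false)] ++ nseq N (j, false)) free_of_wordM gmulfM.
rewrite -[pres _](mulVKg (pres (free_of_word w))).
have [_ LM _] := sL; apply: LM => //.
apply: (gam_layer (letters_is_subgroup c r A0)); rewrite -gmulfV -gmulfM.
apply: pres_gam; apply: gam2_exponent_sum => k.
rewrite wE exponent_sum_nseq [LHS]mxE [X in (_ + X)%R]mxE summxE.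
have [kA|kA] := boolP (k \in A0).
  rewrite (bigD1 k) //= big1 => [|k' /andP[_ k'k]]; last first.
    by rewrite !mxE (eq_sym k) (negbTE k'k) andbF mulr0.
  rewrite !mxE !eqxx mulr1 addr0 subrr.
  by case: eqP jA => [->|_ _]; [rewrite kA|rewrite mul0rn].
rewrite big1 ?subr0 ?yC // => k' k'A; rewrite !mxE.
by have [e|] := eqVneq k k'; [rewrite e k'A in kA|rewrite andbF mulr0].
Qed.

Lemma letters_transversal : int_rank (remove_cols M A0) = #|~: A0| ->
  exists T : seq G, forall x, exists2 t, t \in T & exists2 h, H h & x = (t * h)%g.
Proof.
move=> /int_left_inverse[N [Z [N0 ZM]]].
apply: (nilpotent_transversal (letters_is_subgroup c r A0) N0 _
  (layer_letter_power ZM) (c := c)); last exact: pres_nilpotent.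
move=> D [D1 DM DV] Dg x; have [y <-] := pres_surj x.
apply: (free_gen_ind (H := [set y | D (pres y)])) => [|j]; last exact: Dg.
split=> [|u v Du Dv|u Du] /=; rewrite ?gmulf1 ?gmulfM ?gmulfV //.
- exact: DM.
- exact: DV.
Qed.

(** The right inverse used to solve the relations, supported outside [A0]. *)
Lemma right_inverse_ex : int_rank (remove_cols M A0) = m ->
  exists (N : int) (Z : 'M[int]_(n, m)), [/\ N != 0, M *m Z = N%:M &
    forall j i, j \in A0 -> Z j i = 0]%R.
Proof.
move=> /int_right_inverse[N [Z [N0 MZ]]].
exists N, (\matrix_(j, i) \sum_(b | enum_val b == j) Z b i)%R; split.
- by rewrite eqz_nat -lt0n.
- rewrite -MZ; apply/matrixP => i k; rewrite !mxE.
  under eq_bigr => j _ do rewrite [X in (_ * X)%R]mxE mulr_sumr.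
  rewrite (exchange_big_dep predT) //=; apply: eq_bigr => b _.
  by rewrite (big_pred1 (enum_val b)) ?mxE // => j; rewrite /= eq_sym.
- move=> j i jA; rewrite mxE big_pred0 // => b; apply/negbTE/eqP => bj.
  by have := enum_valP b; rewrite bj inE jA.
Qed.
End Roots.

(** Let all generators act as the identity of the rationals in degree one: the
    linear coefficient of a power is then its exponent. *)
Lemma zpow_free_gen_gam2 n (j : 'I_n) e :
  lower_central (free_group n) 2 (zpow (free_gen j) e) -> e = 0%R.
Proof.
pose t (i : 'I_n) : endo rat^o := 1%R.
move=> /(Ufilt_magnus (k := 2) t isT) /ulead0P.
have zpowE : magnus t (zpow (free_gen j) e) = zpow (magnus t (free_gen j)) e.
  by case: e => k /=; rewrite ?gmulfV gmulfXn.
rewrite zpowE => /lead_uniq /(_ (ulead_zpow e (ltn0Sn 0) (ulead_magnus_gen t j))).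
move=> /(congr1 (fun l : endo rat^o => l 1%R)).
by rewrite endoE_zero endoE_mulrz endoE_one => /esym/eqP; rewrite intr_eq0 => /eqP.
Qed.

Lemma letters_infinite_cyclic c m n (r : 'I_m -> word n) (A0 : {set 'I_n}) :
    (1 <= c)%N -> int_rank (remove_cols (relation_matrix r) A0) = m ->
    #|A0| = 1%N ->
  infinite_cyclic (letters_subgroup c r A0).
Proof.
move=> c1 /right_inverse_ex[N [Z [N0 MZ Z0]]] /eqP/cards1P[a A0E].
have aA : a \in A0 by rewrite A0E set11.
split.
  exists (presented_gen c r a); rewrite /letters_subgroup A0E.
  congr generated; apply/seteqP; split=> [_ [j /set1P-> ->] //|_ ->].
  by exists a => //; rewrite finset.set11.
pose q := enum_rank_in aA a.
pose f (e : nat) := pres c r (sub_letters (free_gen q ^+ e)).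
have f_inj : injective f.
  move=> e e' ee'; have : Posz e = Posz e'; last by case.
  apply/eqP; rewrite -subr_eq0; apply/eqP; apply: (@zpow_free_gen_gam2 _ q).
  apply: (@gam_le _ 2 c.+1 _ c1); apply: (letters_free N0 MZ Z0).
  by rewrite zpowB 2!gmulfM 2!gmulfV; move: ee'; rewrite /f /= => ->; rewrite mulgV.
move=> Hfin; apply: infinite_nat.
have fH e : letters_subgroup c r A0 (f e).
  by rewrite -letters_range; exists (free_gen q ^+ e).
have -> : [set: nat] = f @^-1` (letters_subgroup c r A0) by apply/seteqP; split=> e _ //; exact: fH.
by apply: finite_preimage => // x y _ _; exact: f_inj.
Qed.

Theorem theorem4p2 (c m n : nat) (r : 'I_m -> word n)
    (hc : (1 <= c)%N) (hr : full_rank r) :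
  let G := presented_group c r in
  let conclusion (A0 : {set 'I_n}) :=
    [/\ (n <= m)%N -> finite_set [set: G]%classic,
        m.+1 = n ->
          infinite_cyclic (letters_subgroup c r A0) /\
          finite_index (letters_subgroup c r A0)
      & (m.+2 <= n)%N ->
          is_free_nilpotent c (n - m) (letters_subgroup c r A0) /\
          finite_index (letters_subgroup c r A0)] in
  (exists A0 : {set 'I_n}, #|A0| = (n - m)%N /\ conclusion A0) /\
  ((m < n)%N ->
   forall A0 : {set 'I_n},
     #|A0| = (n - m)%N ->
     int_rank (relation_matrix r) =
       int_rank (remove_cols (relation_matrix r) A0) ->
     conclusion A0).
Proof.
move=> G conclusion.
have below (A0 : {set 'I_n}) : (m < n)%N -> #|A0| = (n - m)%N ->
    int_rank (remove_cols (relation_matrix r) A0) = m -> conclusion A0.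
  move=> mn cA rA.
  have cC : #|~: A0| = m by rewrite cardsCs finset.setCK card_ord cA subKn // ltnW.
  have [T TP] := letters_transversal c (etrans rA (esym cC)).
  have fin := transversal_finite_index (letters_is_subgroup c r A0) TP.
  split=> [|nE|_]; first by rewrite leqNgt mn.
    split=> //; apply: letters_infinite_cyclic => //.
    by rewrite cA -nE subSnn.
  split=> //; have [N [Z [N0 MZ Z0]]] := right_inverse_ex rA.
  by rewrite -cA; exact: letters_free_nilpotent N0 MZ Z0.
split; last first.
  move=> mn A0 cA rE; apply: below => //.
  by rewrite -rE hr; apply/minn_idPl/ltnW.
have [nm|mn] := leqP n m; last first.
  have rM : int_rank (relation_matrix r) = m by rewrite hr; apply/minn_idPl/ltnW.
  have [J [cJ rJ]] := independent_columns rM.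
  by exists J; split=> //; exact: below.
exists finset.set0; split; first by rewrite cards0; apply/esym/eqP.
split=> [_|nE|]; last by lia.
  have rA : int_rank (remove_cols (relation_matrix r) finset.set0) =
      #|~: (finset.set0 : {set 'I_n})|.
    apply/eqP; rewrite eqn_leq rank_leq_col /=.
    apply: leq_trans (remove_cols_set0 _); rewrite hr finset.setC0 cardsT card_ord.
    by rewrite leq_min nm leqnn.
  have [T TP] := letters_transversal c rA.
  apply: sub_finite_set (finite_seq T) => x _ /=.
  have [t tT [h Hh ->]] := TP x.
  suff -> : h = 1 by rewrite mulg1.
  apply: (generated_ind (P := [set y | y = 1]) _ _ Hh) => [|y [j]]; last by rewrite inE.
  by split=> [//|_ _ -> ->|_ ->]; rewrite ?mulg1 ?invg1.
by lia.
Qed.
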